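(* Let $q\in\mathbf C$ with $0<|q|<1$, let $R=\mathrm{Diag}(\rho_1,\rho_2)$, $S=\mathrm{Diag}(\sigma_1,\sigma_2)$ with $\rho_i,\sigma_i\in\mathbf C^*$, and $\underline x=\{x_1,x_2,x_3,x_4\}\subset\mathbf C^*$, subject to (FR), (NR), (NS) of the context. Let $M\in F_{R,S,\underline x}$ and let $M=PQ$ be a Mano decomposition with factor $C\in\mathrm{GL}_2(\mathbf C)$. (i) Let $\Lambda\in\mathrm{GL}_2(\mathcal O(\mathbf C^* ))$ be such that $\Lambda[C]:=(\sigma_q\Lambda)C\Lambda^{-1}\in\mathrm{GL}_2(\mathbf C)$. Put $P':=P\Lambda^{-1}$, $Q':=\Lambda Q$, $C':=\Lambda[C]$. Then $M=P'Q'$ is a Mano decomposition with factor $C'$. (ii) All Mano decompositions of $M$ are obtained in this way.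
   Context: Notation: $\sigma_qf(x):=f(qx)$ (entrywise on matrices); $a\equiv b$ means $a/b\in q^{\mathbf Z}$; $\mathcal O(\mathbf C^* )$ is the ring of holomorphic functions on $\mathbf C^*$, and $\mathrm{GL}_2(\mathcal O(\mathbf C^* ))$ is the group of matrices invertible over this ring. Conditions: (FR) $x_1x_2x_3x_4\equiv\rho_1\rho_2/(\sigma_1\sigma_2)$. (NR) $\rho_1/\rho_2,\ \sigma_1/\sigma_2\notin q^{\mathbf Z}$ and $x_k/x_l\notin q^{\mathbf Z}$ for $1\le k<l\le4$. (NS) $\rho_i/\sigma_j\not\equiv x_1x_2$ for all $i,j\in\{1,2\}$. $F_{R,S,\underline x}$ is the set of $M\in\mathrm{Mat}_2(\mathcal O(\mathbf C^* ))$ with $\sigma_qM=RM(Sx^2)^{-1}$, $\det M$ not identically zero, and $\det M$ vanishing at $x_1,x_2,x_3,x_4$. A Mano decomposition $M=PQ$ with factor $C\in\mathrm{GL}_2(\mathbf C)$ is given by $P,Q\in\mathrm{Mat}_2(\mathcal O(\mathbf C^* ))$ such that $M=PQ$, $\sigma_qP=RP(Cx)^{-1}$ and $\det P$ vanishes at $x_1$ and $x_2$. *)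

(* Defs.v *)
From HB Require Import structures.
From mathcomp Require Import all_boot all_order all_algebra.
From mathcomp Require Import complex.
From mathcomp Require Import all_classical all_reals all_analysis.
Import Order.TTheory GRing.Theory Num.Theory.
Import numFieldNormedType.Exports.

Set Implicit Arguments.
Unset Strict Implicit.
Unset Printing Implicit Defensive.

Local Open Scope classical_set_scope.
Local Open Scope complex_scope.
Local Open Scope ring_scope.

(* Functions and matrix-valued functions on C^* are represented by total
   functions on C = R[i] whose value at 0 is irrelevant: every condition and
   every identity below is imposed at nonzero points only. *)

(* Both sides carry the R[i]-normed-module structure, so [derivable] along 1
   is complex differentiability. *)
Definition holomorphic_Cstar (R : realType) (f : R[i] -> R[i]) : Prop :=
  forall z : R[i], z != 0 -> derivable (f : R[i]^o -> R[i]^o) z 1.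

Definition mat_holo (R : realType) (A : R[i] -> 'M[R[i]]_2) : Prop :=
  forall i j : 'I_2, holomorphic_Cstar (fun z => A z i j).

Definition GL_holo (R : realType) (A : R[i] -> 'M[R[i]]_2) : Prop :=
  mat_holo A /\
  exists B : R[i] -> 'M[R[i]]_2, mat_holo B /\
    forall z : R[i], z != 0 -> A z *m B z = 1%:M /\ B z *m A z = 1%:M.

Definition qpower (R : realType) (q a : R[i]) : Prop :=
  exists n : int, a = q ^ n.

Definition qequiv (R : realType) (q a b : R[i]) : Prop := qpower q (a / b).

Definition sigma_q (R : realType) (T : Type) (q : R[i]) (f : R[i] -> T) :
  R[i] -> T := fun z => f (q * z).

Definition diag2 (R : realType) (d : 'I_2 -> R[i]) : 'M[R[i]]_2 :=
  diag_mx (\row_i d i).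

Definition FR (R : realType) (q : R[i]) (rho sigma : 'I_2 -> R[i])
    (x : 'I_4 -> R[i]) : Prop :=
  qequiv q (\prod_k x k) (\prod_i rho i / \prod_i sigma i).

Definition NR (R : realType) (q : R[i]) (rho sigma : 'I_2 -> R[i])
    (x : 'I_4 -> R[i]) : Prop :=
  [/\ ~ qpower q (rho 0 / rho 1), ~ qpower q (sigma 0 / sigma 1) &
      forall k l : 'I_4, (k < l)%N -> ~ qpower q (x k / x l)].

Definition NS (R : realType) (q : R[i]) (rho sigma : 'I_2 -> R[i])
    (x : 'I_4 -> R[i]) : Prop :=
  forall i j : 'I_2, ~ qequiv q (rho i / sigma j) (x 0 * x 1).

Definition F_set (R : realType) (q : R[i]) (A B : 'M[R[i]]_2)
    (x : 'I_4 -> R[i]) : set (R[i] -> 'M[R[i]]_2) :=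
  [set M | [/\ mat_holo M,
     forall z, z != 0 -> sigma_q q M z = A *m M z *m invmx (z ^+ 2 *: B),
     exists2 z, z != 0 & \det (M z) != 0 &
     forall k : 'I_4, \det (M (x k)) = 0]].

(* [A] is the left factor R of the functional equation; [C] is the factor of
   the decomposition [M = P Q]. *)
Definition Mano_decomposition (R : realType) (q : R[i]) (A : 'M[R[i]]_2)
    (x : 'I_4 -> R[i]) (M P Q : R[i] -> 'M[R[i]]_2) (C : 'M[R[i]]_2) : Prop :=
  [/\ C \in unitmx, mat_holo P /\ mat_holo Q,
      forall z, z != 0 -> M z = P z *m Q z,
      forall z, z != 0 -> sigma_q q P z = A *m P z *m invmx (z *: C) &
      \det (P (x 0)) = 0 /\ \det (P (x 1)) = 0].

Definition gauge (R : realType) (q : R[i]) (L : R[i] -> 'M[R[i]]_2)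
    (C : 'M[R[i]]_2) : R[i] -> 'M[R[i]]_2 :=
  fun z => sigma_q q L z *m C *m invmx (L z).

Definition gauge_to (R : realType) (q : R[i]) (L : R[i] -> 'M[R[i]]_2)
    (C C' : 'M[R[i]]_2) : Prop :=
  C' \in unitmx /\ forall z, z != 0 -> gauge q L C z = C'.

(* Main.v *)
Require Import Defs.
From mathcomp Require Import all_boot all_order all_algebra.
From mathcomp Require Import complex.
From mathcomp Require Import all_classical all_reals all_analysis.
From mathcomp Require Import ring lra zify.
Import Order.TTheory GRing.Theory Num.Theory.
Import numFieldNormedType.Exports.
Local Open Scope classical_set_scope.
Local Open Scope complex_scope.
Local Open Scope ring_scope.

(** If P and P' are the left factors of two decompositions, the factor relating
    them is L = P'^-1 P = Q' Q^-1, so the point is that P' and Q are never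
    singular simultaneously on C^*. Now det P, det P', det Q and det Q' are
    theta functions of degree two, f (q z) = c z^-2 f z, and such a function, if
    not identically zero, vanishes on at most two q-orbits: hence det P and
    det P' vanish exactly on the orbits of x1 and x2, and det Q and det Q'
    exactly on those of x3 and x4, which are disjoint.

    Suppose that f vanished on three distinct orbits, of a1, a2, a3. Let T_N be
    the product over 1 <= n <= N and i of (1 - z q^n / a_i) (1 - a_i q^n / z).
    On the circles |z| = |q|^(+-(N + m)) one has |T_N| >= c^N |q|^(-3 N^2 / 2),
    while f only grows like C^N |q|^(-N^2); the maximum principle for f / T_N
    then forces f = 0.

    As holomorphy is mere complex differentiability, the maximum principle is
    obtained from Goursat's bisection argument, in the coordinate s on the
    punctured disc z = z0 + e^s: the mean of the real part over a circle does not
    depend on the radius. *)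

Set Implicit Arguments.
Unset Strict Implicit.
Unset Printing Implicit Defensive.

(** * Goursat's theorem for closed real forms on a rectangle *)

Section RealGoursat.
Context {R : realType}.
Implicit Types (a b c d x y : R).

Lemma continuous_has_antiderivative (f : R -> R) (a : R) :
  continuous f ->
  exists F : R -> R, forall x, a < x -> is_derive x 1 F (f x).
Proof.
move=> cf; exists (fun x => (\int[lebesgue_measure]_(t in `[a, x]) f t)%R).
move=> x ax.
have fi : lebesgue_measure.-integrable `[a, x + 1] (EFin \o f).
  apply: continuous_compact_integrable; first exact: segment_compact.
  exact: continuous_subspaceT.
have [|dF <-] := continuous_FTC1_closed _ fi ax (cf x).
  by rewrite ltrDl.
by rewrite derive1E; exact/derivableP.
Qed.

(** The mean value theorem for [F] minus the primitive of the affine approximation. It controls one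
    edge of a small rectangle without integrating [f]. *)
Lemma increment_affine_approx (F f : R -> R) (a b al be p eta : R) : a <= b ->
  (forall x, a <= x <= b -> is_derive x 1 F (f x)) ->
  (forall x, a <= x <= b -> `|f x - (al + be * (x - p))| <= eta) ->
  `|F b - F a - (al * (b - a) + be * ((b - p) ^+ 2 - (a - p) ^+ 2) / 2)|
    <= eta * (b - a).
Proof.
move=> ab dF bnd.
pose G x := F x - (al * x + be / 2 * (x - p) ^+ 2).
have dG x : a <= x <= b -> is_derive x 1 G (f x - (al + be * (x - p))).
  move=> /dF ?; have -> : G = F - ((al \*: id) + ((be / 2) \*: ((id - cst p) ^+ 2))).
    by apply/funext => t; rewrite /G /=.
  apply: is_derive_eq; rewrite /= /GRing.scale /=.
  have -> : (id - cst p) x = x - p by [].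
  by rewrite mulr1 subr0 mulr1 expr1; congr (_ - (_ + _)); field.
have cG : {within `[a, b], continuous G}.
  apply: derivable_within_continuous => x; rewrite in_itv /= => /dG ?.
  exact: ex_derive.
have [c cab E] := @MVT_segment R G _ a b ab
  (fun x h => dG x ltac:(by move: h; rewrite in_itv /= => /andP[/ltW -> /ltW ->])) cG.
have -> : F b - F a - (al * (b - a) + be * ((b - p) ^+ 2 - (a - p) ^+ 2) / 2)
   = G b - G a by rewrite /G; field.
rewrite E normrM (ger0_norm (_ : 0 <= b - a)) ?subr_ge0//.
by apply: ler_wpM2r; rewrite ?subr_ge0//; apply: bnd; move: cab; rewrite in_itv.
Qed.

Lemma dist_le_width (x p a b : R) :
  a <= x <= b -> a <= p <= b -> `|x - p| <= b - a.
Proof.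
by move=> /andP[? ?] /andP[? ?]; rewrite ler_norml; apply/andP; split; lra.
Qed.

(* A rectangle [a, b] x [c, d] is encoded as ((a, b), (c, d)). *)
Local Notation rect := ((R * R) * (R * R))%type.

Let lo (I : R * R) := (I.1, (I.1 + I.2) / 2).
Let hi (I : R * R) := ((I.1 + I.2) / 2, I.2).

(** Otherwise every bad rectangle has a bad quarter, and nested bad quarters shrink to a point
    around which all small rectangles are good. *)
Lemma rect_bisection (good : rect -> Prop) (a b c d : R) : a <= b -> c <= d ->
  (forall I J, good (lo I, lo J) -> good (lo I, hi J) ->
     good (hi I, lo J) -> good (hi I, hi J) -> good (I, J)) ->
  (forall p r, a <= p <= b -> c <= r <= d -> exists2 e, 0 < e &
     forall a' b' c' d', a <= a' <= p -> p <= b' <= b -> c <= c' <= r ->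
       r <= d' <= d -> (b' - a') + (d' - c') < e -> good ((a', b'), (c', d'))) ->
  good ((a, b), (c, d)).
Proof.
move=> ab cd split local; apply: contrapT => bad0.
(* The implication stays under the existential so that choice yields a total function; nothing is
   asked of its value on good rectangles. *)
have step (Q : rect) : exists Q' : rect, ~ good Q ->
    ~ good Q' /\ (Q'.1 = lo Q.1 \/ Q'.1 = hi Q.1)
    /\ (Q'.2 = lo Q.2 \/ Q'.2 = hi Q.2).
  case: Q => I J.
  have [g1|b1] := pselect (good (lo I, lo J)); last first.
    by exists (lo I, lo J) => _; split=> //; split; left.
  have [g2|b2] := pselect (good (lo I, hi J)); last first.
    by exists (lo I, hi J) => _; split=> //; split; [left|right].
  have [g3|b3] := pselect (good (hi I, lo J)); last first.
    by exists (hi I, lo J) => _; split=> //; split; [right|left].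
  have [g4|b4] := pselect (good (hi I, hi J)); last first.
    by exists (hi I, hi J) => _; split=> //; split; right.
  by exists (I, J) => nb; exfalso; apply: nb; apply: split.
have [st stP] := choice step.
pose Q n := iter n st ((a, b), (c, d)).
have badQ n : ~ good (Q n).
  by elim: n => [//|n ih]; have [] := stP _ ih.
have stepQ n := (stP _ (badQ n)).2.
(* Nested intervals in one coordinate, used for both; the common point is the supremum of the left
   ends. *)
have nested (I : nat -> R * R) : (I 0%N).1 <= (I 0%N).2 ->
    (forall n, I n.+1 = lo (I n) \/ I n.+1 = hi (I n)) ->
    exists p, forall n, [/\ (I 0%N).1 <= (I n).1 <= p, p <= (I n).2 <= (I 0%N).2
      & (I n).2 - (I n).1 = ((I 0%N).2 - (I 0%N).1) / 2 ^+ n].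
  move=> I0 IS.
  have Iw n : (I n).2 - (I n).1 = ((I 0%N).2 - (I 0%N).1) / 2 ^+ n.
    elim: n => [|n ih]; first by rewrite expr0 divr1.
    rewrite exprS invfM mulrCA -ih.
    by case: (IS n) => -> /=; field.
  have Ile n : (I n).1 <= (I n).2.
    by rewrite -subr_ge0 Iw divr_ge0 ?subr_ge0// exprn_ge0.
  have I1S n : (I n).1 <= (I n.+1).1.
    by have := Ile n; case: (IS n) => -> /= h; lra.
  have I2S n : (I n.+1).2 <= (I n).2.
    by have := Ile n; case: (IS n) => -> /= h; lra.
  have I1m : {homo (fun n => (I n).1) : m n / (m <= n)%N >-> m <= n}.
    exact: homo_leq le_trans I1S.
  have I2m : {homo (fun n => (I n).2) : m n / (m <= n)%N >-> n <= m}.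
    by apply: homo_leq => [//|u v w h1 h2|//]; exact: le_trans h2 h1.
  have I12 m n : (I m).1 <= (I n).2.
    apply: (le_trans (I1m _ (maxn m n) (leq_maxl _ _))).
    apply: (le_trans (Ile _)); exact: (I2m _ (maxn m n) (leq_maxr _ _)).
  pose S := [set (I n).1 | n in [set: nat]].
  have S0 : S !=set0 by exists (I 0%N).1; exists 0%N.
  exists (sup S) => n; split => //.
  - rewrite (I1m 0%N)//=; apply: ub_le_sup; last by exists n.
    by exists (I 0%N).2 => _ [m _ <-]; exact: I12.
  - rewrite (I2m 0%N)// andbT; apply: ge_sup => // _ [m _ <-].
    exact: I12.
have [p hp] := nested (fun n => (Q n).1) ab (fun n => (stepQ n).1).
have [r hr] := nested (fun n => (Q n).2) cd (fun n => (stepQ n).2).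
rewrite /= in hp hr.
have pab : a <= p <= b.
  by have [/andP[h1 h2] /andP[h3 h4] _] := hp 0%N; rewrite h2 h3.
have rcd : c <= r <= d.
  by have [/andP[h1 h2] /andP[h3 h4] _] := hr 0%N; rewrite h2 h3.
have [e e0 loc] := local p r pab rcd.
pose w := (b - a) + (d - c).
have w0 : 0 <= w by rewrite addr_ge0// subr_ge0.
have [n wn] : exists n, w < e * 2 ^+ n.
  exists (Num.bound (w / e)); rewrite mulrC -ltr_pdivrMr//.
  apply: (lt_le_trans (archi_boundP _)); first by rewrite divr_ge0// ltW.
  rewrite -natrX ler_nat; exact/ltnW/ltn_expl.
have [h1 h2 h3] := hp n; have [h4 h5 h6] := hr n.
apply: (badQ n); move: h1 h2 h3 h4 h5 h6; case: (Q n) => [[a' b'] [c' d']] /=.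
move=> h1 h2 h3 h4 h5 h6; apply: loc => //.
by rewrite h3 h6 -mulrDl ltr_pdivrMr// exprn_gt0.
Qed.

(* The closed form is v dx + u dy, closed in the sense that v_y = u_x holds
   pointwise; V and U are antiderivatives of its restrictions to horizontal and
   vertical lines, so that the conclusion is the vanishing of its integral along
   the boundary. No continuity of the partial derivatives is assumed. *)
Lemma goursat_rectangle (u v U V : R -> R -> R) (a b c d : R) :
  a <= b -> c <= d ->
  (forall x y, a <= x <= b -> c <= y <= d -> is_derive x 1 (V^~ y) (v x y)) ->
  (forall x y, a <= x <= b -> c <= y <= d -> is_derive y 1 (U x) (u x y)) ->
  (forall p r, a <= p <= b -> c <= r <= d -> exists A B C : R,
    forall eps, 0 < eps -> exists2 e, 0 < e &
    forall x y, a <= x <= b -> c <= y <= d -> `|x - p| + `|y - r| < e ->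
     `|u x y - (u p r + A * (x - p) + B * (y - r))|
        <= eps * (`|x - p| + `|y - r|) /\
     `|v x y - (v p r + C * (x - p) + A * (y - r))|
        <= eps * (`|x - p| + `|y - r|)) ->
  V b c - V a c - (V b d - V a d) + (U b d - U b c) - (U a d - U a c) = 0.
Proof.
move=> ab cd dV dU lin.
pose I (Q : rect) := let: ((a, b), (c, d)) := Q in
  V b c - V a c - (V b d - V a d) + (U b d - U b c) - (U a d - U a c).
suff bound eps : 0 < eps ->
    `|I ((a, b), (c, d))| <= eps * ((b - a) + (d - c)) ^+ 2.
  apply/eqP; rewrite -normr_le0; apply/ler_addgt0Pl => e e0.
  rewrite addr0; set w := ((b - a) + (d - c)) ^+ 2 in bound.
  have w0 : 0 <= w by exact: sqr_ge0.
  have w1 : 0 < w + 1 by lra.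
  apply: (le_trans (bound (e / (w + 1)) _)); first by rewrite divr_gt0.
  rewrite mulrAC ler_pdivrMr//; apply: ler_wpM2l; lra.
move=> eps0.
(* Halving both sides divides the squared half-perimeter by four, so the bounds of the four quarters
   add up to that of the whole. *)
pose good (Q : rect) := `|I Q| <=
  eps * ((Q.1.2 - Q.1.1) + (Q.2.2 - Q.2.1)) ^+ 2.
apply: (@rect_bisection good) => //.
- move=> [a1 b1] [c1 d1]; rewrite /good /I /=.
  set m := (a1 + b1) / 2; set n := (c1 + d1) / 2.
  have -> : m - a1 = (b1 - a1) / 2 by rewrite /m; field.
  have -> : b1 - m = (b1 - a1) / 2 by rewrite /m; field.
  have -> : n - c1 = (d1 - c1) / 2 by rewrite /n; field.
  have -> : d1 - n = (d1 - c1) / 2 by rewrite /n; field.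
  have -> : (b1 - a1) / 2 + (d1 - c1) / 2 = ((b1 - a1) + (d1 - c1)) / 2 by field.
  rewrite expr_div_n; set w := (_ ^+ 2).
  clearbody m n w.
  set i1 := (X in `|X| <= _); set i2 := (X in _ -> `|X| <= _ -> _).
  set i3 := (X in _ -> _ -> `|X| <= _ -> _).
  set i4 := (X in _ -> _ -> _ -> `|X| <= _ -> _) => h1 h2 h3 h4.
  have -> : V b1 c1 - V a1 c1 - (V b1 d1 - V a1 d1) + (U b1 d1 - U b1 c1)
      - (U a1 d1 - U a1 c1) = i1 + i2 + i3 + i4.
    rewrite /i1 /i2 /i3 /i4.
    move: (V b1 c1) (V a1 c1) (V b1 d1) (V a1 d1) (U b1 d1) (U b1 c1)
      (U a1 d1) (U a1 c1) (V m c1) (V m d1) (V a1 n) (V b1 n) (V m n)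
      (U m c1) (U m d1) (U a1 n) (U b1 n) (U m n) => *; ring.
  apply: (@le_trans _ _ (`|i1| + `|i2| + `|i3| + `|i4|)); last by lra.
  apply: le_trans (ler_normD _ _) _; rewrite lerD2r.
  apply: le_trans (ler_normD _ _) _; rewrite lerD2r.
  exact: ler_normD.
- move=> p r pab rcd.
  have [A [B [C linABC]]] := lin p r pab rcd.
  (* With sides [w] and [h], each edge contributes an error of at most [eps / 2 * (w + h)] times its
     length, and the perimeter is [2 * (w + h)]. *)
  have [|e e0 he] := linABC (eps / 2); first by rewrite divr_gt0.
  exists e => // a1 b1 c1 d1 /andP[aa1 a1p] /andP[pb1 b1b] /andP[cc1 c1r]
    /andP[rd1 d1d] small.
  rewrite /good /I /=; set w := b1 - a1; set h := d1 - c1.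
  have near x y : a1 <= x <= b1 -> c1 <= y <= d1 -> `|x - p| + `|y - r| <= w + h.
    by move=> hx hy; apply: lerD; apply: dist_le_width => //; rewrite ?a1p ?c1r.
  have sub x y : a1 <= x <= b1 -> c1 <= y <= d1 -> a <= x <= b /\ c <= y <= d.
    move=> /andP[ax xb] /andP[cy yd].
    rewrite (le_trans aa1 ax) (le_trans xb b1b) (le_trans cc1 cy).
    by rewrite (le_trans yd d1d).
  have bnd x y : a1 <= x <= b1 -> c1 <= y <= d1 ->
     `|u x y - (u p r + A * (x - p) + B * (y - r))| <= eps / 2 * (w + h) /\
     `|v x y - (v p r + C * (x - p) + A * (y - r))| <= eps / 2 * (w + h).
    move=> hx hy; have [hx' hy'] := sub x y hx hy.
    have nxy := near x y hx hy.
    have [|h1 h2] := he x y hx' hy'; first exact: le_lt_trans small.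
    have e2 : 0 <= eps / 2 by rewrite divr_ge0// ltW.
    by split; [apply: le_trans h1 _|apply: le_trans h2 _]; apply: ler_wpM2l.
  have a1b1 : a1 <= b1 by exact: le_trans pb1.
  have c1d1 : c1 <= d1 by exact: le_trans rd1.
  have Vedge y : c1 <= y <= d1 -> `|V b1 y - V a1 y -
     ((v p r + A * (y - r)) * w + C * ((b1 - p) ^+ 2 - (a1 - p) ^+ 2) / 2)|
      <= eps / 2 * (w + h) * w.
    move=> hy; apply: (@increment_affine_approx (V^~ y) (v^~ y)) => // x hx.
      by have [? ?] := sub x y hx hy; exact: dV.
    have [_] := bnd x y hx hy.
    by rewrite -addrA [C * _ + _]addrC addrA.
  have Uedge x : a1 <= x <= b1 -> `|U x d1 - U x c1 -
     ((u p r + A * (x - p)) * h + B * ((d1 - r) ^+ 2 - (c1 - r) ^+ 2) / 2)|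
      <= eps / 2 * (w + h) * h.
    move=> hx; apply: (@increment_affine_approx (U x) (u x)) => // y hy.
      by have [? ?] := sub x y hx hy; exact: dU.
    by have [] := bnd x y hx hy.
  have := Vedge c1; rewrite lexx c1d1 => /(_ erefl).
  have := Vedge d1; rewrite lexx c1d1 => /(_ erefl).
  have := Uedge a1; rewrite lexx a1b1 => /(_ erefl).
  have := Uedge b1; rewrite lexx a1b1 => /(_ erefl).
  set e1 := (X in `|X| <= _); set e2 := (X in _ -> `|X| <= _ -> _).
  set e3 := (X in _ -> _ -> `|X| <= _ -> _).
  set e4 := (X in _ -> _ -> _ -> `|X| <= _ -> _) => h1 h2 h3 h4.
  (* The affine parts cancel: constant and quadratic terms agree on opposite edges, and the two
     mixed terms [A * w * h] have opposite signs because [A] is shared. *)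
  have -> : V b1 c1 - V a1 c1 - (V b1 d1 - V a1 d1) + (U b1 d1 - U b1 c1)
      - (U a1 d1 - U a1 c1) = e4 - e3 + e1 - e2.
    rewrite /e1 /e2 /e3 /e4 /w /h.
    move: (V b1 c1) (V a1 c1) (V b1 d1) (V a1 d1) (U b1 d1) (U b1 c1)
      (U a1 d1) (U a1 c1) (v p r) (u p r) => *; by field.
  apply: (@le_trans _ _ (`|e4| + `|e3| + `|e1| + `|e2|)).
    apply: le_trans (ler_normB _ _) _; rewrite lerD2r.
    apply: le_trans (ler_normD _ _) _; rewrite lerD2r.
    exact: ler_normB.
  apply: le_trans (lerD (lerD (lerD h4 h3) h1) h2) _.
  by rewrite le_eqVlt; apply/orP; left; apply/eqP; clear; field.
Qed.

End RealGoursat.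

(** * The complex exponential *)

(** Clearing the denominator of the difference quotient gives a first-order estimate that includes
    [h = 0] and serves both the real and the complex field. *)
Lemma is_derive_approxP (K : numFieldType) (f : K^o -> K^o) (x df : K^o) :
  is_derive x 1 f df <->
  forall eps : K, 0 < eps -> exists2 d : K, 0 < d &
    forall h, `|h| < d -> `|f (x + h) - f x - df * h| <= eps * `|h|.
Proof.
split.
- move=> [dfx Ef] eps eps0.
  have : (fun h => h^-1 *: ((f \o shift x) (h *: 1) - f x)) @ 0^' --> df.
    by rewrite -Ef; exact: dfx.
  move/cvgrPdist_le => /(_ _ eps0).
  move=> /nbhs_ballP[d /= d0 hd]; exists d => // h hh.
  have [->|h0] := eqVneq h 0; first by rewrite addr0 mulr0 subr0 subrr normr0 mulr0.
  have := hd h; rewrite /ball /= sub0r normrN => /(_ hh h0).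
  rewrite /GRing.scale /= mulr1 [h + x]addrC.
  have -> : f (x + h) - f x - df * h = (h^-1 * (f (x + h) - f x) - df) * h.
    by field.
  by rewrite normrM distrC => H; apply: ler_wpM2r.
- move=> H.
  have L : (fun h => h^-1 *: ((f \o shift x) (h *: 1) - f x)) @ 0^' --> df.
    apply/cvgrPdist_le => eps eps0.
    have [d d0 hd] := H _ eps0.
    apply/nbhs_ballP; exists d => //= h; rewrite /ball /= sub0r normrN => hh h0.
    rewrite /GRing.scale /= mulr1 [h + x]addrC distrC.
    have -> : h^-1 * (f (x + h) - f x) - df = (f (x + h) - f x - df * h) / h.
      by field.
    by rewrite normrM normfV ler_pdivrMr ?normr_gt0//; exact: hd.
  split; [by apply/cvg_ex; exists df|exact/cvg_lim].
Qed.

Section Complex.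
Context {R : realType}.
Local Notation C := R[i].
Implicit Types (z w s : C).

Local Notation normc := (@Normc.normc R).

(** The norm of [R[i]] takes values in [R[i]]; [normc] is the same number in [R], where order and
    compactness arguments take place. *)
Lemma normrE_normc z : `|z| = (normc z)%:C.
Proof. by []. Qed.

Lemma normc_ge0 z : 0 <= normc z.
Proof. by rewrite -ler0c -normrE_normc. Qed.

Lemma Re_le_normc z : `|complex.Re z| <= normc z.
Proof. by rewrite -lecR -normrE_normc; exact: normc_ge_Re. Qed.

Lemma Im_le_normc z : `|complex.Im z| <= normc z.
Proof.
have := Re_le_normc (z * 'i%C); rewrite Normc.normcM ReiNIm normrN.
by rewrite {2}/Normc.normc expr0n /= expr1n add0r sqrtr1 mulr1.
Qed.

Lemma normc_le_ReIm z : normc z <= `|complex.Re z| + `|complex.Im z|.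
Proof.
case: z => a b /=.
rewrite -(@ler_pXn2r _ 2)// ?nnegrE ?addr_ge0 ?sqrtr_ge0//.
rewrite sqr_sqrtr ?addr_ge0 ?sqr_ge0// sqrrD !real_normK ?num_real//.
by rewrite lerD2r lerDl mulrn_wge0// mulr_ge0.
Qed.

Lemma nbhs_normcP (z : C^o) (P : set C^o) :
  nbhs z P <-> exists2 e : R, 0 < e & forall w, normc (w - z) < e -> P w.
Proof.
split.
- move=> /nbhs_ballP[e /= e0 H].
  have eR : e = (complex.Re e)%:C by rewrite RRe_real// gtr0_real.
  exists (complex.Re e); first by move: e0; rewrite eR ltcR.
  move=> w hw; apply: H; rewrite /ball /= distrC normrE_normc eR ltcR.
  exact: hw.
- move=> [e e0 H]; apply/nbhs_ballP; exists e%:C => /=; first by rewrite ltcR.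
  by move=> w; rewrite /ball /= distrC normrE_normc ltcR => /H.
Qed.

Lemma is_derive_normc (f : C^o -> C^o) (z D : C^o) : is_derive z 1 f D ->
  forall eps : R, 0 < eps -> exists2 d : R, 0 < d &
    forall h, normc h < d -> normc (f (z + h) - f z - D * h) <= eps * normc h.
Proof.
move=> /is_derive_approxP H eps eps0.
have [|d d0 hd] := H eps%:C; first by rewrite ltcR.
have dR : d = (complex.Re d)%:C by rewrite RRe_real// gtr0_real.
exists (complex.Re d); first by move: d0; rewrite dR ltcR.
move=> h hh; have := hd h; rewrite !normrE_normc dR ltcR => /(_ hh).
by rewrite -rmorphM lecR.
Qed.

Definition cexp (s : C) : C :=
  Complex (expR (complex.Re s) * cos (complex.Im s))
          (expR (complex.Re s) * sin (complex.Im s)).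

Lemma cexpD s w : cexp (s + w) = cexp s * cexp w.
Proof.
case: s w => [a b] [c d]; rewrite /cexp /= expRD cosD sinD.
by apply/eqP; rewrite eq_complex /=; apply/andP; split; apply/eqP; ring.
Qed.

Lemma normc_cexp s : normc (cexp s) = expR (complex.Re s).
Proof.
rewrite /cexp /= !exprMn -mulrDr cos2Dsin2 mulr1 sqrtr_sqr.
by rewrite ger0_norm// expR_ge0.
Qed.

Lemma cexp_periodic x y : cexp (Complex x (y + pi *+ 2)) = cexp (Complex x y).
Proof. by rewrite /cexp /= cosD2pi sinD2pi. Qed.

(** By [cexpD] only the increment at 0 matters; its real and imaginary parts are estimated from the
    derivatives of [expR], [cos] and [sin] at 0. *)
Lemma is_derive_cexp (s : C^o) : is_derive s 1 (cexp : C^o -> C^o) (cexp s).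
Proof.
apply/is_derive_approxP => e e0.
have [e' e'0 ->] : exists2 e' : R, 0 < e' & e = e'%:C.
  have eR : e = (complex.Re e)%:C by rewrite RRe_real// gtr0_real.
  by exists (complex.Re e) => //; move: e0; rewrite eR ltcR.
pose M := expR (complex.Re s).
have M0 : 0 < M by exact: expR_gt0.
(* The 9 collects 4 from the real and 5 from the imaginary part of [cexp h - 1 - h]; [eta <= 1]
   keeps the values of [expR] involved below 3. *)
pose eta := Num.min 1 (e' / (M * 9)).
have eta0 : 0 < eta by rewrite lt_min ltr01 divr_gt0// mulr_gt0.
have eta1 : eta <= 1 by rewrite ge_min lexx.
have etaM : M * (9 * eta) <= e'.
  by rewrite mulrA mulrC -ler_pdivlMr ?mulr_gt0// ge_min lexx orbT.
clearbody eta.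
have approx (f : R -> R) df : is_derive (0:R) 1 f df -> exists2 d : R, 0 < d &
    forall h, `|h| < d -> `|f h - f 0 - df * h| <= eta * `|h|.
  move=> /is_derive_approxP /(_ _ eta0)[d d0 H]; exists d => // h /H.
  by rewrite add0r.
have [d1 d10 H1] := approx _ _ (is_derive_expR (0:R)).
have [d2 d20 H2] := approx _ _ (is_derive_cos (0:R)).
have [d3 d30 H3] := approx _ _ (is_derive_sin (0:R)).
(* A radius of at most [eta] makes the quadratic term [(expR a - 1) * b] at most [2 * eta] times the
   modulus of the increment. *)
exists (Num.min (Num.min d1 eta) (Num.min d2 d3))%:C.
  by rewrite ltcR !lt_min d10 d20 d30 eta0.
move=> h; rewrite !normrE_normc ltcR !lt_min -andbA => /and4P[h1 h2 h3 h4].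
rewrite -rmorphM lecR cexpD.
have -> : cexp s * cexp h - cexp s - cexp s * h = cexp s * (cexp h - 1 - h).
  by ring.
rewrite Normc.normcM normc_cexp -/M.
case: h h1 h2 h3 h4 => a b h1 h2 h3 h4.
set n := normc _ in h1 h2 h3 h4 *.
have an : `|a| <= n by exact: (Re_le_normc (Complex a b)).
have bn : `|b| <= n by exact: (Im_le_normc (Complex a b)).
have n0 : 0 <= n by exact: normc_ge0.
have E1 := H1 a (le_lt_trans an h1).
have E2 := H2 b (le_lt_trans bn h3).
have E3 := H3 b (le_lt_trans bn h4).
rewrite expR0 mul1r in E1; rewrite cos0 sin0 oppr0 mul0r subr0 in E2.
rewrite sin0 cos0 mul1r subr0 in E3.
have ea : `|a| < 1 by apply: le_lt_trans an (lt_le_trans h2 eta1).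
have Eexp : `|expR a - 1| <= 2 * n.
  have -> : expR a - 1 = (expR a - 1 - a) + a by ring.
  apply: le_trans (ler_normD _ _) _.
  have := ler_wpM2r (normr_ge0 a) eta1; lra.
have Eexp3 : `|expR a| <= 3.
  have -> : expR a = (expR a - 1 - a) + a + 1 by ring.
  apply: le_trans (ler_normD _ _) _.
  apply: le_trans (lerD (ler_normD _ _) (lexx _)) _.
  rewrite normr1; have := ler_wpM2r (normr_ge0 a) eta1; lra.
have big : normc (cexp (Complex a b) - 1 - Complex a b) <= 9 * eta * n.
  apply: le_trans (normc_le_ReIm _) _; rewrite /= !subr0.
  have -> : expR a * cos b - 1 - a = (expR a - 1 - a) + expR a * (cos b - 1) by ring.
  have -> : expR a * sin b - b = expR a * (sin b - b) + (expR a - 1) * b by ring.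
  have T1 : `|expR a * (cos b - 1)| <= 3 * (eta * n).
    rewrite normrM; apply: ler_pM => //; apply: le_trans E2 _.
    by apply: ler_wpM2l => //; exact: ltW.
  have T2 : `|expR a * (sin b - b)| <= 3 * (eta * n).
    rewrite normrM; apply: ler_pM => //; apply: le_trans E3 _.
    by apply: ler_wpM2l => //; exact: ltW.
  have := ler_normD (expR a - 1 - a) (expR a * (cos b - 1)).
  have := ler_normD (expR a * (sin b - b)) ((expR a - 1) * b).
  have T3 : `|(expR a - 1) * b| <= 2 * (eta * n).
    rewrite normrM.
    rewrite mulrCA mulrC.
    apply: ler_pM => //; apply: (le_trans bn); exact: ltW.
  have T4 : eta * `|a| <= eta * n by apply: ler_wpM2l => //; exact: ltW.
  move: E1 T1 T2 T3 T4; clear; lra.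
apply: (@le_trans _ _ (M * (9 * eta * n))); first by apply: ler_wpM2l => //; exact: ltW.
by rewrite mulrA; apply: ler_wpM2r.
Qed.
End Complex.

(** * Mean values over circles *)

Lemma derivable_compose (K : numFieldType) (f g : K^o -> K^o) (x : K^o) :
  derivable f x 1 -> derivable g (f x) 1 -> derivable (fun y => g (f y)) x 1.
Proof.
move=> /derivable1_diffP df /derivable1_diffP dg; apply/derivable1_diffP.
exact: (differentiable_comp df dg).
Qed.

Section MeanValue.
Context {R : realType}.
Local Notation C := R[i].
Implicit Types (z w s : C).

Local Notation normc := (@Normc.normc R).

Lemma continuous_normcP (f : C^o -> C^o) (z : C^o) :
  {for z, continuous f} <->
  forall eps : R, 0 < eps -> exists2 d : R, 0 < d &
    forall w, normc (w - z) < d -> normc (f w - f z) < eps.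
Proof.
have cP := @cvgrPdist_lt _ C^o _ (nbhs z) _ f (f z).
split.
- move=> /cP cf eps eps0; have := cf eps%:C.
  rewrite ltcR => /(_ eps0)/nbhs_normcP[d d0 H]; exists d => // w /H /=.
  by rewrite distrC normrE_normc ltcR.
- move=> H; apply/cP => e e0.
  have eR : e = (complex.Re e)%:C by rewrite RRe_real// gtr0_real.
  have [|d d0 hd] := H (complex.Re e); first by move: e0; rewrite eR ltcR.
  apply/nbhs_normcP; exists d => // w /hd.
  by rewrite distrC normrE_normc eR ltcR.
Qed.

Lemma derivable_continuous (f : C^o -> C^o) (z : C^o) :
  derivable f z 1 -> {for z, continuous f}.
Proof. by move=> /derivable1_diffP/differentiable_continuous. Qed.

(** Goursat's theorem for the closed form Im K dx + Re K dy on a rectangle of height 2 pi: the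
    horizontal edges cancel by periodicity, so the integral of Re K over a vertical period does not
    depend on x. By the mean value theorem Re K attains this mean on each period. *)
Lemma derivable_circle_mean (K : C^o -> C^o) (s0 : R) :
  (forall s, complex.Re s < s0 -> derivable K s 1) ->
  (forall x y, K (Complex x (y + pi *+ 2)) = K (Complex x y)) ->
  exists m, forall x, x < s0 -> exists t, complex.Re (K (Complex x t)) = m.
Proof.
move=> dK perK.
have cK s : complex.Re s < s0 -> {for s, continuous K}.
  by move=> /dK; exact: derivable_continuous.
(* Choosing the primitive as a function of the integrand gives equal integrands the same primitive,
   which [Vper] relies on. *)
have [prim primP] : exists prim : R -> (R -> R) -> (R -> R), forall (a : R) (f : R -> R),
    continuous f -> forall x : R, a < x -> is_derive x 1 (prim a f) (f x).
  have /choice[g gP] : forall p : R * (R -> R), exists F : R -> R,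
      continuous p.2 -> forall x : R, p.1 < x -> is_derive x 1 F (p.2 x).
    move=> [a f] /=; have [cf|ncf] := pselect (continuous f); last by exists f.
    by have [F hF] := continuous_has_antiderivative a cf; exists F.
  by exists (fun a f => g (a, f)) => a f; exact: (gP (a, f)).
(* Truncation by [Num.min] extends the row continuously to the whole line, while K is controlled
   only for real part below [s0]. *)
have crow (x2 y : R) : x2 < s0 ->
    continuous (fun x => complex.Im (K (Complex (Num.min x x2) y))).
  move=> x2s x; apply/cvgrPdist_lt => e e0.
  have [|d d0 hd] := (continuous_normcP _ _).1 (cK (Complex (Num.min x x2) y) _) e e0.
    by rewrite /= gt_min x2s orbT.
  apply/nbhs_ballP; exists d => //= t; rewrite /ball /= => xt.
  rewrite distrC -(raddfB (@complex.Im R : Rcomplex R -> R)).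
  apply: le_lt_trans (Im_le_normc _) _; apply: hd.
  apply: le_lt_trans (normc_le_ReIm _) _; rewrite /= subrr normr0 addr0.
  apply: le_lt_trans xt.
  have hp := ler_norm (x - t); have := ler_norm (t - x).
  rewrite [in X in X -> _]distrC => hn; rewrite ler_norml.
  by have [?|?] := leP t x2; have [?|?] := leP x x2; apply/andP; split; lra.
have ccol (x : R) : x < s0 -> continuous (fun y => complex.Re (K (Complex x y))).
  move=> xs y; apply/cvgrPdist_lt => e e0.
  have [|d d0 hd] := (continuous_normcP _ _).1 (cK (Complex x y) _) e e0 => //.
  apply/nbhs_ballP; exists d => //= t; rewrite /ball /= => xt.
  rewrite distrC -(raddfB (@complex.Re R : Rcomplex R -> R)).
  apply: le_lt_trans (Re_le_normc _) _; apply: hd.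
  by apply: le_lt_trans (normc_le_ReIm _) _; rewrite /= subrr normr0 add0r distrC.
(* Primitives start one unit before the interval, so that they have the right derivative at its left
   end too. *)
pose U (x : R) := prim (-1) (fun y => complex.Re (K (Complex x y))).
have dU (x y : R) : x < s0 -> 0 <= y ->
    is_derive y 1 (U x) (complex.Re (K (Complex x y))).
  by move=> xs y0; apply: (primP _ _ (ccol x xs)); lra.
have pi2 : 0 < pi *+ 2 :> R by rewrite mulrn_wgt0// pi_gt0.
pose J (x : R) := U x (pi *+ 2) - U x 0.
have Jle (x1 x2 : R) : x1 <= x2 -> x2 < s0 -> J x1 = J x2.
  move=> x12 x2s.
  pose V (x y : R) := prim (x1 - 1) (fun x => complex.Im (K (Complex (Num.min x x2) y))) x.
  have := @goursat_rectangle R (fun x y => complex.Re (K (Complex x y)))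
    (fun x y => complex.Im (K (Complex x y))) U V x1 x2 0 (pi *+ 2) x12 (ltW pi2).
  have Vper x : V x (pi *+ 2) = V x 0.
    rewrite /V; congr (prim _ _ _); apply/funext => t.
    by rewrite -(perK _ 0) add0r.
  rewrite !Vper subrr add0r => G; apply/eqP; rewrite eq_sym -subr_eq0; apply/eqP.
  apply: G => [x y /andP[x1x xx2] _|x y /andP[x1x xx2] /andP[y0 _]|].
  - have := primP (x1 - 1) _ (crow x2 y x2s) x ltac:(lra).
    by rewrite (min_l xx2).
  - by apply: dU => //; exact: le_lt_trans x2s.
  - move=> p r /andP[_ px2] _.
    have /derivableP/is_derive_normc := dK (Complex p r) (le_lt_trans px2 x2s).
    set D := 'D_1 K _ => HD.
    (* The Cauchy-Riemann equations: the real part of [D] is the coefficient shared by both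
       components. *)
    exists (complex.Re D), (- complex.Im D), (complex.Im D) => eps eps0.
    have [d d0 hd] := HD eps eps0; exists d => // x y _ _ xyd.
    have hn : normc (Complex (x - p) (y - r)) <= `|x - p| + `|y - r|.
      exact: normc_le_ReIm.
    have := hd _ (le_lt_trans hn xyd).
    have -> : Complex p r + Complex (x - p) (y - r) = Complex x y.
      by apply/eqP; rewrite eq_complex /=; apply/andP; split; apply/eqP; ring.
    set E := _ - _ - _ => hE.
    have {}hE : normc E <= eps * (`|x - p| + `|y - r|).
      by apply: le_trans hE _; apply: ler_wpM2l => //; exact: ltW.
    have := le_trans (Re_le_normc E) hE; have := le_trans (Im_le_normc E) hE.
    rewrite /E; move: D {HD hd hE E} => D.
    case: (K (Complex x y)) (K (Complex p r)) D => [k1 k2] [l1 l2] [D1 D2] /=.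
    by move=> h1 h2; split; [move: h2|move: h1]; congr (`|_| <= _); ring.
exists (J (s0 - 1) / (pi *+ 2)) => x xs.
have Jx : J x = J (s0 - 1).
  have [h|h] := leP x (s0 - 1); first by apply: Jle => //; lra.
  by rewrite (Jle (s0 - 1) x) // ltW.
have [|t _ E] := @MVT R (U x) _ 0 (pi *+ 2) pi2 
  (fun y hy => dU x y xs ltac:(by move: hy; rewrite in_itv /= => /andP[/ltW -> _])).
  apply: derivable_within_continuous => y; rewrite in_itv /= => /andP[y0 _].
  by have ? := dU x y xs y0; exact: ex_derive.
exists t; rewrite -Jx /J E subr0 mulfK//.
by rewrite gt_eqF.
Qed.

(** Under [z = z0 + cexp s] circles about [z0] become vertical periods with a common mean, and
    shrinking the radius identifies it with the value at the centre. As [k] is differentiable off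
    the centre and continuous at it, quotients extended by continuity are covered. *)
Lemma circle_meets_center_value (k : C^o -> C^o) (z0 : C^o) (rho : R) :
  (forall z, 0 < normc (z - z0) < rho -> derivable k z 1) ->
  {for z0, continuous k} ->
  forall r, 0 < r < rho -> exists2 z, normc (z - z0) = r &
    complex.Re (k z) = complex.Re (k z0).
Proof.
move=> dk ck r /andP[r0 rrho].
have rho0 : 0 < rho by exact: lt_trans rrho.
pose K (s : C^o) : C^o := k (z0 + cexp s).
have dist s : normc (z0 + cexp s - z0) = expR (complex.Re s).
  by rewrite addrAC subrr add0r normc_cexp.
have [||m hm] := @derivable_circle_mean K (ln rho).
- move=> s hs.
  have ds : derivable (fun s : C^o => (z0 + cexp s : C^o)) s 1.
    have ? := is_derive_cexp s; apply: derivableD; first exact: derivable_cst.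
    exact: ex_derive.
  have dz : derivable k (z0 + cexp s) 1.
    by apply: dk; rewrite dist expR_gt0 -[ltRHS]lnK ?posrE// ltr_expR.
  exact: (derivable_compose ds dz).
- by move=> x y; rewrite /K cexp_periodic.
suff <- : m = complex.Re (k z0).
  have [|t ht] := hm (ln r); first by rewrite ltr_ln ?posrE.
  by exists (z0 + cexp (Complex (ln r) t)); rewrite ?dist/= ?lnK ?posrE.
apply/eqP; rewrite -subr_eq0 -normr_le0; apply/ler_addgt0Pl => e e0.
have [d d0 hd] := (continuous_normcP _ _).1 ck e e0; rewrite addr0.
pose r' := Num.min (r / 2) (d / 2).
have r'0 : 0 < r' by rewrite lt_min !divr_gt0.
have [|t <-] := hm (ln r').
  by rewrite ltr_ln ?posrE// gt_min; apply/orP; left; lra.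
rewrite -(raddfB (@complex.Re R : Rcomplex R -> R)).
apply: le_trans (Re_le_normc _) _; apply/ltW/hd.
by rewrite dist /= lnK ?posrE// gt_min; apply/orP; right; lra.
Qed.

End MeanValue.

(** * The maximum principle *)

Lemma derivable_affine_comb (K : numFieldType) (a b c : K^o) (g : K^o -> K^o)
    (z : K^o) : derivable g z 1 ->
  derivable (fun w : K^o => a * g w + b * (w - c) : K^o) z 1.
Proof.
move=> dg.
have d1 : derivable (a \*: g) z 1 by exact: derivableZ.
have d2 : derivable (b \*: (id - cst c) : K^o -> K^o) z 1.
  by apply: derivableZ; apply: derivableB; [exact: derivable_id|exact: derivable_cst].
exact: (derivableD d1 d2).
Qed.

Lemma continuous_affine_comb (K : numFieldType) (a b c : K^o) (g : K^o -> K^o)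
    (z : K^o) : {for z, continuous g} ->
  {for z, continuous (fun w : K^o => a * g w + b * (w - c) : K^o)}.
Proof.
move=> cg; have c1 := continuousM (@cst_continuous K^o K^o a z) cg.
have c2 := @continuousB K K^o K^o id (cst c) z (@cvg_id K^o (nbhs z)) (@cst_continuous K^o K^o c z).
have c3 := continuousM (@cst_continuous K^o K^o b z) c2.
exact: (@continuousD K K^o K^o _ _ z c1 c3).
Qed.

Section MaxPrinciple.
Context {R : realType}.
Local Notation C := R[i].
Implicit Types (z w s : C).

Local Notation normc := (@Normc.normc R).

Lemma normc_distB z w : `|normc z - normc w| <= normc (z - w).
Proof.
have := le_normcD (z - w) w; rewrite subrK => h1.
have := le_normcD (w - z) z; rewrite subrK -opprB normcN => h2.
by rewrite ler_norml; apply/andP; split; lra.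
Qed.

Lemma normc_continuous : continuous (normc : C^o -> R).
Proof.
move=> z; have cP := @cvgrPdist_lt _ R^o _ (nbhs (z : C^o)) _ normc (normc z).
apply/cP => e e0; apply/nbhs_normcP; exists e => // w hw.
by apply: le_lt_trans hw; rewrite distrC; exact: normc_distB.
Qed.

Lemma continuous_normc_comp (g : C^o -> C^o) (z : C^o) :
  {for z, continuous g} -> {for z, continuous (fun w : C^o => normc (g w) : R^o)}.
Proof.
by move=> cg; exact: (@continuous_comp C^o C^o R^o g normc z cg (@normc_continuous (g z))).
Qed.

Lemma compact_annulus (r1 r2 : R) :
  compact ([set z | r1 <= normc z <= r2] : set C^o).
Proof.
pose I : set R := [set` `[- r2, r2]].
pose h (p : R * R) : C^o := Complex p.1 p.2.
have ch : continuous h.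
  move=> p.
  have cP := @cvgrPdist_lt _ C^o _ (nbhs p) _ h (h p).
  apply/cP => e e0.
  have eR : e = (complex.Re e)%:C by rewrite RRe_real// gtr0_real.
  have e'0 : 0 < complex.Re e by move: e0; rewrite eR ltcR.
  rewrite eR; apply/nbhs_ballP; exists (complex.Re e / 2); first by rewrite /= divr_gt0.
  move=> t [/=]; rewrite /ball /= => h1 h2.
  rewrite normrE_normc ltcR; apply: le_lt_trans (normc_le_ReIm _) _ => /=.
  by lra.
have cI : compact (h @` (I `*` I)).
  apply: continuous_compact; first exact: continuous_subspaceT.
  by apply: compact_setX; exact: segment_compact.
apply: (subclosed_compact _ cI).
- rewrite (_ : [set z | _] = (normc : C^o -> R) @^-1` [set` `[r1, r2]]); last first.
    by apply/seteqP; split => z /=; rewrite ?in_itv.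
  apply: closed_comp => [z _|]; first exact: normc_continuous.
  exact: interval_closed.
- move=> [x y] /= /andP[_ xr]; exists (x, y) => //; split => /=;
    rewrite /I /= in_itv /= -ler_norml; apply: le_trans xr.
  + exact: (Re_le_normc (Complex x y)).
  + exact: (Im_le_normc (Complex x y)).
Qed.

Lemma complex_ReD z w : complex.Re (z + w) = complex.Re z + complex.Re w.
Proof. by case: z w => [a b] [c d]. Qed.

Lemma normc_sqrD z h : normc (z + h) ^+ 2 =
  normc z ^+ 2 + 2 * complex.Re (conjc z * h) + normc h ^+ 2.
Proof.
case: z h => [a b] [c d] /=.
by rewrite !sqr_sqrtr ?addr_ge0 ?sqr_ge0//; ring.
Qed.

(** If the bound failed, |g| + eta |z|^2 would have an interior maximum [z0] for small [eta]. A
    holomorphic [k] built from [g] regains its central real part at some point of a circle about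
    [z0], and there the sum exceeds its maximum by at least [eta] times the squared radius. *)
Lemma max_principle_annulus (g : C^o -> C^o) (r1 r2 B : R) : 0 < r1 ->
  (forall z, r1 <= normc z <= r2 -> {for z, continuous g}) ->
  (forall z, r1 < normc z < r2 -> exists2 rho : R, 0 < rho &
     forall w, 0 < normc (w - z) < rho -> derivable g w 1) ->
  (forall z, normc z = r1 \/ normc z = r2 -> normc (g z) <= B) ->
  forall z, r1 <= normc z <= r2 -> normc (g z) <= B.
Proof.
move=> r10 cg dg bnd z1 hz1; rewrite leNgt; apply/negP => z1B.
have r20 : 0 < r2 by case/andP: hz1 => h1 h2; apply: lt_le_trans r10 (le_trans h1 h2).
have B0 : 0 <= B.
  apply: le_trans (normc_ge0 (g r1%:C)) (bnd _ _); left.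
  by rewrite /= expr0n /= addr0 sqrtr_sqr gtr0_norm.
(* Small enough that [eta * r2 ^+ 2] stays below the excess of [normc (g z1)] over [B], which
   excludes a maximum on the boundary. *)
pose eta := (normc (g z1) - B) / (r2 ^+ 2 + 1).
have r21 : 0 < r2 ^+ 2 + 1 by have := sqr_ge0 r2; lra.
have eta0 : 0 < eta by rewrite divr_gt0// subr_gt0.
have etaB : B + eta * r2 ^+ 2 < normc (g z1).
  have -> : normc (g z1) = B + eta * (r2 ^+ 2 + 1).
    by rewrite /eta; field; rewrite gt_eqF.
  by rewrite mulrDr mulr1; move: eta0; clear; lra.
clearbody eta.
pose u (z : C^o) : R := normc (g z) + eta * normc z ^+ 2.
have [||z0 /set_mem /= z0A maxu] := @compact_EVT_max C^o R u _ _ (@compact_annulus r1 r2) _.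
- by exists z1.
- apply: continuous_in_subspaceT => z /set_mem /= zA.
  have c1 := continuous_normc_comp (cg z zA).
  have c2 := @normc_continuous z.
  have c3 : {for z, continuous (fun w : C^o => eta * normc w ^+ 2 : R^o)}.
    have c4 := @continuousM R C^o _ _ z c2 c2.
    by have := @continuousM R C^o (cst eta) _ z (@cst_continuous C^o R^o eta z) c4.
  exact: (@continuousD R R^o C^o _ _ z c1 c3).
have {}maxu z : r1 <= normc z <= r2 -> u z <= u z0.
  by move=> h; apply: maxu; exact: mem_set.
have le_eta z : r1 <= normc z <= r2 -> eta * normc z ^+ 2 <= eta * r2 ^+ 2.
  move=> /andP[_ h]; apply: ler_wpM2l; first exact: ltW.
  by rewrite ler_pXn2r// nnegrE ?normc_ge0// ltW.
have uz0 : B + eta * r2 ^+ 2 < u z0.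
  apply: lt_le_trans etaB (le_trans _ (maxu _ hz1)).
  by rewrite /u lerDl mulr_ge0 ?sqr_ge0// ltW.
have interior r : (r = r1 \/ r = r2) -> normc z0 <> r.
  move=> hr z0r; have : normc (g z0) <= B by apply: bnd; rewrite z0r.
  by have := le_eta _ z0A; move: uz0; rewrite /u; clear; lra.
have z0i : r1 < normc z0 < r2.
  case/andP: z0A => h1 h2; rewrite !lt_neqAle h1 h2 !andbT.
  apply/andP; split; apply/eqP => E; first by apply: (interior r1); [left|].
  by apply: (interior r2); [right|].
have [rho rho0 drho] := dg _ z0i.
case/andP: z0i => z0r1 z0r2.
pose m := Num.min rho (Num.min (normc z0 - r1) (r2 - normc z0)).
have m0 : 0 < m by rewrite !lt_min rho0 !subr_gt0 z0r1.
have a0 : 0 < normc (g z0).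
  by have := le_eta _ z0A; move: uz0 B0; rewrite /u; clear; lra.
set a := g z0 in a0.
(* A unimodular number that rotates [g z0] to its modulus. *)
pose ph : C := conjc a / (normc a)%:C.
have naC : (normc a)%:C != 0 by rewrite (inj_eq (@complexI R)) gt_eqF.
have pha : ph * a = (normc a)%:C.
  by rewrite /ph mulrAC [conjc a * a]mulrC -sqr_normc -normrE_normc expr2 mulfK.
have phn : normc ph = 1.
  apply: (mulIf (negbT (gt_eqF a0))).
  by rewrite -Normc.normcM pha mul1r /= expr0n /= addr0 sqrtr_sqr gtr0_norm.
(* The real part of the linear term is the first variation of [eta * normc z ^+ 2] at [z0]. *)
pose k (z : C^o) : C^o := ph * g z + (2 * eta%:C * conjc z0) * (z - z0).
have [|||z zr kz] := @circle_meets_center_value R k z0 m _ _ (m / 2).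
- move=> z /andP[zz0 zm]; have dgz : derivable g z 1.
    by apply: drho; rewrite zz0 (lt_le_trans zm)// ge_min lexx.
  exact: derivable_affine_comb.
- have := @continuous_affine_comb C ph (2 * eta%:C * conjc z0) z0 g z0 (cg z0 z0A); exact.
- by apply/andP; split; lra.
have hz : z = z0 + (z - z0) by rewrite addrCA subrr addr0.
have mb : m <= normc z0 - r1 /\ m <= r2 - normc z0.
  by rewrite /m !ge_min !lexx !orbT.
have zA : r1 <= normc z <= r2.
  have := normc_distB z z0; rewrite zr ler_norml => /andP[h1 h2].
  by move: mb m0 h1 h2 z0r1 z0r2; clear => -[? ?] ? ? ? ? ?; apply/andP; split; lra.
have := maxu z zA; rewrite /u {2}hz normc_sqrD zr.
move: kz; rewrite /k subrr mulr0 addr0 pha complex_ReD.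
have -> : complex.Re (2 * eta%:C * conjc z0 * (z - z0)) =
    2 * eta * complex.Re (conjc z0 * (z - z0)).
  rewrite -[_ * _ * (z - z0)]mulrA (_ : 2 * eta%:C = (2 * eta)%:C); last first.
    by rewrite rmorphM rmorph_nat.
  by case: (conjc z0 * (z - z0)) => x y /=; ring.
set t := complex.Re (conjc z0 * (z - z0)).
have := le_trans (ler_norm _) (Re_le_normc (ph * g z)).
rewrite Normc.normcM phn mul1r /= => h1 h2 h3.
have : 0 < eta * (m / 2) ^+ 2 by rewrite mulr_gt0// exprn_gt0// divr_gt0.
move: h1 h2 h3; rewrite -/a; clear; nra.
Qed.

End MaxPrinciple.

(** * Quotients of holomorphic functions at simple zeros of the denominator *)

Section Quotient.
Context {R : realType}.
Local Notation C := R[i].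
Implicit Types (z w s : C).

Local Notation normc := (@Normc.normc R).

Lemma normc_gt0 z : (0 < normc z) = (z != 0).
Proof. by rewrite -normr_gt0 normrE_normc ltcR. Qed.

Lemma normc_eq0 z : (normc z == 0) = (z == 0).
Proof. by apply/negb_inj; rewrite -normc_gt0 lt_neqAle normc_ge0 andbT eq_sym. Qed.

(** This completed difference quotient serves both to isolate zeros and to remove singularities of
    quotients. *)
Lemma continuous_slope (f : C^o -> C^o) (z : C^o) : derivable f z 1 ->
  {for z, continuous (fun w : C^o =>
     if w == z then 'D_1 f z else (f w - f z) / (w - z) : C^o)}.
Proof.
move=> /derivableP/is_derive_normc df; apply/continuous_normcP => e e0.
have [|d d0 hd] := df (e / 2); first by rewrite divr_gt0.
exists d => // w wz; rewrite eqxx; case: eqP => [_|/eqP wz0].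
  by rewrite subrr Normc.normc0.
have wz1 : w - z != 0 by rewrite subr_eq0.
have := hd _ wz; rewrite addrCA subrr addr0.
set D := 'D_1 f z; have -> : f w - f z - D * (w - z) =
  ((f w - f z) / (w - z) - D) * (w - z) by rewrite mulrBl divfK.
rewrite Normc.normcM ler_pM2r ?normc_gt0// => H.
by apply: le_lt_trans H _; lra.
Qed.

Lemma nbhs_neq0 (f : C^o -> C^o) (z : C^o) : {for z, continuous f} -> f z != 0 ->
  exists2 d : R, 0 < d & forall w, normc (w - z) < d -> f w != 0.
Proof.
move=> /continuous_normcP cf fz0.
have [|d d0 hd] := cf (normc (f z)); first by rewrite normc_gt0.
exists d => // w /hd; apply: contraTneq => ->.
by rewrite sub0r normcN ltxx.
Qed.

(** At a zero, [f w] is [w - z] times the completed difference quotient, which is nonzero at [z] and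
    hence nearby. *)
Lemma isolated_simple_zero (f : C^o -> C^o) (z : C^o) : derivable f z 1 ->
  (f z = 0 -> 'D_1 f z != 0) ->
  exists2 d : R, 0 < d & forall w, 0 < normc (w - z) < d -> f w != 0.
Proof.
move=> df simple; have [fz|fz] := eqVneq (f z) 0; last first.
  have [d d0 hd] := nbhs_neq0 (derivable_continuous df) fz.
  by exists d => // w /andP[_ /hd].
have [|d d0 hd] := nbhs_neq0 (continuous_slope df); first by rewrite eqxx simple.
exists d => // w /andP[]; rewrite normc_gt0 subr_eq0 => wz /hd.
by rewrite (negPf wz) fz subr0; apply: contraNneq => ->; rewrite mul0r.
Qed.

Lemma near_derivable (f g : C^o -> C^o) (z : C^o) (d : R) : 0 < d ->
  (forall w, normc (w - z) < d -> f w = g w) ->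
  derivable f z 1 -> derivable g z 1.
Proof.
move=> d0 fg; apply: near_eq_derivable; apply/nbhs_normcP.
by exists d.
Qed.

Lemma near_continuous (f g : C^o -> C^o) (z : C^o) (d : R) : 0 < d ->
  (forall w, normc (w - z) < d -> f w = g w) ->
  {for z, continuous f} -> {for z, continuous g}.
Proof.
move=> d0 fg /continuous_normcP cf; apply/continuous_normcP => e e0.
have [d' d'0 hd] := cf e e0; exists (Num.min d d'); first by rewrite lt_min d0.
move=> w; rewrite lt_min => /andP[h1 h2].
by rewrite -!fg ?hd// subrr Normc.normc0.
Qed.

(* At a zero of T the quotient f / T is extended by l'Hospital's rule. *)
Lemma max_principle_quotient (f T : C^o -> C^o) (r1 r2 B : R) : 0 < r1 ->
  (forall z, z != 0 -> derivable f z 1) ->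
  (forall z, z != 0 -> derivable T z 1) ->
  (forall z, z != 0 -> T z = 0 -> f z = 0 /\ 'D_1 T z != 0) ->
  (forall z, normc z = r1 \/ normc z = r2 ->
     T z != 0 /\ normc (f z) <= B * normc (T z)) ->
  forall z, r1 <= normc z <= r2 -> normc (f z) <= B * normc (T z).
Proof.
move=> r10 df dT simple bnd z hz.
pose g (w : C^o) : C^o := if T w == 0 then 'D_1 f w / 'D_1 T w else f w / T w.
have dg w : w != 0 -> T w != 0 -> derivable g w 1.
  move=> w0 Tw; have [d d0 hd] := nbhs_neq0 (derivable_continuous (dT _ w0)) Tw.
  apply: (near_derivable d0 (f := fun w => f w * (T w)^-1)).
    by move=> t /hd; rewrite /g => /negPf ->.
  exact: (derivableM (df _ w0) (derivableV Tw (dT _ w0))).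
have isoT w : w != 0 ->
    exists2 d : R, 0 < d & forall t, 0 < normc (t - w) < d -> T t != 0.
  move=> w0; apply: isolated_simple_zero; first exact: dT.
  by move=> /(simple _ w0)[].
have cg w : w != 0 -> {for w, continuous g}.
  move=> w0; have [Tw|Tw] := eqVneq (T w) 0; last exact: derivable_continuous (dg _ w0 Tw).
  have [fw DT] := simple _ w0 Tw; have [d d0 hd] := isoT _ w0.
  (* Near a common zero [f / T] is the ratio of the two difference quotients, and that of [T] does
     not vanish at [w]. *)
  have cf := continuous_slope (df _ w0); have cT := continuous_slope (dT _ w0).
  have cTV : {for w, continuous (fun t : C^o =>
    (if t == w then 'D_1 T w else (T t - T w) / (t - w))^-1 : C^o)}.
    by apply: continuousV cT; rewrite eqxx.
  apply: (near_continuous d0 _ (continuousM cf cTV)) => t td /=.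
  rewrite /g fw Tw; have [->|tw] := eqVneq t w; first by rewrite Tw eqxx.
  have tw0 : t - w != 0 by rewrite subr_eq0.
  have Tt : T t != 0 by apply: hd; rewrite td normc_gt0 tw0.
  by rewrite (negPf Tt) !subr0 invf_div mulrA divfK.
have nz w : r1 <= normc w -> w != 0.
  by move=> h; rewrite -normc_gt0; exact: lt_le_trans h.
have gB : normc (g z) <= B.
  apply: (@max_principle_annulus R g r1 r2 B) hz => //.
  - by move=> w /andP[/nz w0 _]; exact: cg.
  - move=> w /andP[/ltW/nz w0 _]; have [d d0 hd] := isoT _ w0.
    exists (Num.min d (normc w)); first by rewrite lt_min d0 normc_gt0.
    move=> t; rewrite lt_min => /and3P[h1 h2 h3]; apply: dg; last by rewrite hd// h1.
    by apply: contraTneq h3 => ->; rewrite sub0r normcN ltxx.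
  - move=> w /bnd[Tw fT]; rewrite /g (negPf Tw) Normc.normcM Normc.normcV.
    by rewrite ler_pdivrMr// normc_gt0.
case/andP: hz => /nz z0 _.
have [Tz|Tz] := eqVneq (T z) 0.
  by have [-> _] := simple _ z0 Tz; rewrite Tz !Normc.normc0 mulr0.
by move: gB; rewrite /g (negPf Tz) Normc.normcM Normc.normcV ler_pdivrMr// normc_gt0.
Qed.

End Quotient.

(** * Theta functions of degree two *)

Lemma expr_lt_exists (R : realType) (t e : R) : 0 < t < 1 -> 0 < e ->
  exists n, t ^+ n < e.
Proof.
move=> /andP[t0 t1] e0.
have : (fun n => t ^+ n) @ \oo --> (0 : R).
  by apply: cvg_expr; rewrite ger0_norm// ltW.
move=> /cvgrPdist_lt/(_ _ e0)[n _ /(_ n (leqnn n))] /=.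
by rewrite sub0r normrN ger0_norm ?exprn_ge0// ?ltW//; exists n.
Qed.

(** From some index on the factors are at most 1/2, so the products decay geometrically. *)
Lemma prod_geometric_small (R : realType) (t E e : R) (n0 : nat) :
  0 < t < 1 -> 0 < E -> 0 < e ->
  exists2 N, (n0 <= N)%N & \prod_(i < N) (E * t ^+ i) < e.
Proof.
move=> t01 E0 e0; have /andP[t0 t1] := t01.
have [n1 hn1] : exists n, t ^+ n < (2 * E)^-1.
  by apply: expr_lt_exists => //; rewrite invr_gt0 mulr_gt0.
pose n2 := maxn n0 n1.
have P0 n : 0 < \prod_(i < n) (E * t ^+ i).
  by apply: prodr_gt0 => i _; rewrite mulr_gt0// exprn_gt0.
have step k : \prod_(i < n2 + k) (E * t ^+ i) <=
    \prod_(i < n2) (E * t ^+ i) * 2^-1 ^+ k.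
  elim: k => [|k ih]; first by rewrite addn0 expr0 mulr1.
  rewrite addnS big_ord_recr exprSr mulrA /=; apply: ler_pM => //.
  - exact: ltW (P0 _).
  - by rewrite mulr_ge0 ?exprn_ge0// ltW.
  - rewrite mulrC -ler_pdivlMr// -invfM.
    apply: le_trans (ltW hn1); rewrite ler_wiXn2l ?ltW//.
    by rewrite (leq_trans (leq_maxr n0 n1))// leq_addr.
have [k hk] : exists k, (2^-1 : R) ^+ k < e / \prod_(i < n2) (E * t ^+ i).
  apply: expr_lt_exists; last by rewrite divr_gt0.
  by rewrite invr_gt0 ltr0n /= invf_lt1// ltr1n.
exists (n2 + k)%N; first by rewrite (leq_trans (leq_maxl _ n1))// leq_addr.
by apply: le_lt_trans (step k) _; rewrite mulrC -ltr_pdivlMr.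
Qed.

Lemma is_derive_one_sub_div (K : numFieldType) (p z : K^o) : z != 0 ->
  is_derive z 1 (fun w : K^o => 1 - p / w : K^o) (p / z ^+ 2).
Proof.
move=> z0.
have d0 := @derivable_cst K K^o K^o 1 z 1.
have d1 : derivable (fun w : K^o => w^-1 : K^o) z 1.
  exact: (@derivableV K K^o id z 1 z0 (@derivable_id K K^o z 1)).
have d2 : derivable (p \*: (fun w : K^o => w^-1 : K^o)) z 1 by exact: derivableZ.
have d3 : derivable (cst 1 - p \*: (fun w : K^o => w^-1 : K^o)) z 1.
  exact: derivableB d0 d2.
split => //; change ('D_1 (cst 1 - p \*: (fun w : K^o => w^-1 : K^o)) z = p / z ^+ 2).
rewrite deriveB//.
rewrite derive_cst deriveZ// (@deriveV K K^o id z 1 z0 (@derivable_id K K^o z 1)) derive_id.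
by rewrite /GRing.scale /= mulr1 sub0r mulrN opprK.
Qed.

(** * Finite products with prescribed simple zeros *)

Section SimpleZeros.
Context {R : realType}.
Local Notation C := R[i].
Implicit Types (z w s p : C).

(** A nonzero value at [z] is allowed: a zero there, if any, is simple. *)
Definition simple_zero_at (T : C^o -> C^o) (z : C^o) :=
  derivable T z 1 /\ (T z = 0 -> 'D_1 T z != 0).

Lemma simple_zero_at_mul (S T : C^o -> C^o) (z : C^o) :
  simple_zero_at S z -> simple_zero_at T z -> S z != 0 \/ T z != 0 ->
  simple_zero_at (fun w : C^o => S w * T w : C^o) z.
Proof.
move=> [dS sS] [dT sT] ST; split; first exact: (derivableM dS dT).
have -> : 'D_1 (fun w : C^o => S w * T w : C^o) z = S z * 'D_1 T z + T z * 'D_1 S z.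
  exact: (deriveM dS dT).
move=> /eqP; rewrite mulf_eq0 => /orP[] /eqP E; rewrite E mul0r ?add0r ?addr0.
  by rewrite mulf_neq0 ?sS//; case: ST; rewrite ?E ?eqxx.
by rewrite mulf_neq0 ?sT//; case: ST; rewrite ?E ?eqxx.
Qed.

(* Two normalizations of a factor vanishing exactly at p, suited to |p| large
   and to |p| small respectively. *)
Definition zfactor (b : bool) (p : C) (z : C^o) : C^o :=
  if b then 1 - z / p else 1 - p / z.

Lemma zfactor_eq0 b p z : p != 0 -> z != 0 -> (zfactor b p z == 0) = (z == p).
Proof.
move=> p0 z0; rewrite /zfactor; case: b; rewrite subr_eq0 eq_sym.
  by rewrite -(inj_eq (mulIf p0)) divfK// mul1r.
by rewrite -(inj_eq (mulIf z0)) divfK// mul1r eq_sym.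
Qed.

Lemma zfactor_simple b p (z : C^o) : p != 0 -> z != 0 ->
  simple_zero_at (zfactor b p) z.
Proof.
move=> p0 z0; have D : is_derive z 1 (zfactor b p)
    (if b then - p^-1 else p / z ^+ 2).
  rewrite /zfactor; case: b; last exact: is_derive_one_sub_div.
  apply/is_derive_approxP => e e0; exists 1 => // h _.
  have -> : 1 - (z + h) / p - (1 - z / p) - - p^-1 * h = 0 by field.
  by rewrite normr0 mulr_ge0// ltW.
split; first by have := @ex_derive _ _ _ _ _ _ _ D.
move=> _; rewrite (@derive_val _ _ _ _ _ _ _ D).
case: (b); first by rewrite oppr_eq0 invr_eq0.
by rewrite mulf_neq0// invr_eq0 expf_eq0.
Qed.

(** The points [p i] are distinct, so at most one factor vanishes at [z] and the product rule leaves
    one nonzero term. *)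
Lemma prod_zfactor_simple (I : eqType) (r : seq I) (b : I -> bool) (p : I -> C)
    (z : C^o) : uniq r -> injective p -> (forall i, p i != 0) -> z != 0 ->
  simple_zero_at (fun w : C^o => \prod_(i <- r) zfactor (b i) (p i) w : C^o) z.
Proof.
move=> + pinj p0 z0; elim: r => [_|i r ih /= /andP[ir ur]].
  have -> : (fun w : C^o => \prod_(i <- [::]) zfactor (b i) (p i) w) = cst 1.
    by apply/funext => w; rewrite big_nil.
  split; first exact: derivable_cst.
  by move=> /eqP; rewrite oner_eq0.
have -> : (fun w : C^o => \prod_(j <- i :: r) zfactor (b j) (p j) w) =
    fun w : C^o => zfactor (b i) (p i) w * \prod_(j <- r) zfactor (b j) (p j) w.
  by apply/funext => w; rewrite big_cons.
apply: simple_zero_at_mul; [exact: zfactor_simple|exact: ih|].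
rewrite zfactor_eq0//; have [zp|] := eqVneq z (p i); [right|by left].
rewrite prodf_seq_neq0; apply/allP => j jr /=.
rewrite zfactor_eq0// zp (inj_eq pinj).
by apply: contraNneq ir => ->.
Qed.

End SimpleZeros.

Section Theta.
Context {R : realType}.
Local Notation C := R[i].
Implicit Types (z w s p : C).

Local Notation normc := (@Normc.normc R).

Lemma normcX z n : normc (z ^+ n) = normc z ^+ n.
Proof.
elim: n => [|n ih]; first by rewrite !expr0 Normc.normc1.
by rewrite !exprS Normc.normcM ih.
Qed.

Lemma normc_prod (I : Type) (r : seq I) (P : pred I) (F : I -> C) :
  normc (\prod_(i <- r | P i) F i) = \prod_(i <- r | P i) normc (F i).
Proof.
apply: (big_morph normc (fun z w => Normc.normcM z w)).
exact: Normc.normc1.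
Qed.

Lemma normc_ge_sub z w : normc z - normc w <= normc (w - z).
Proof. by apply: le_trans (ler_norm _) _; rewrite distrC; exact: normc_distB. Qed.

Lemma bounded_on_unit_circle (f : C^o -> C^o) :
  (forall z, z != 0 -> {for z, continuous f}) ->
  exists2 B : R, 0 < B & forall z, normc z = 1 -> normc (f z) <= B.
Proof.
move=> cf.
have [||z0 _ maxu] := @compact_EVT_max C^o R (fun z : C^o => normc (f z)) _ _
    (@compact_annulus R 1 1) _.
- by exists 1; change (1 <= normc 1 <= 1); rewrite Normc.normc1 lexx.
- apply: continuous_in_subspaceT => z /set_mem /= /andP[z1 _].
  apply: continuous_normc_comp; apply: cf.
  by rewrite -normc_gt0; exact: lt_le_trans z1.
exists (normc (f z0) + 1); first by rewrite ltr_wpDl// normc_ge0.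
move=> z z1; apply: le_trans (_ : normc (f z0) <= _); last by rewrite lerDl.
by apply: maxu; apply: mem_set; rewrite /= z1 lexx.
Qed.

(** * Vanishing of a theta function of degree two with zeros on three orbits *)

Section ThreeZeros.
Variables (q c : C) (f : C^o -> C^o).
Hypothesis q_range : 0 < normc q < 1.
Hypothesis c_neq0 : c != 0.
Hypothesis f_derivable : forall z, z != 0 -> derivable f z 1.
Hypothesis f_eq : forall z, z != 0 -> f (q * z) = c * z ^- 2 * f z.

Local Notation t := (normc q).
Local Notation s := (normc q)^-1.
(** One constant for both directions: a step outwards evaluates [z ^+ 2] one circle further out than
    a step inwards, hence the [s ^+ 2]. *)
Let gamma := Num.max (normc c) (normc c)^-1 * s ^+ 2.

Let q_neq0 : q != 0.
Proof. by rewrite -normc_gt0; case/andP: q_range. Qed.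

Let s_gt0 : 0 < s.
Proof. by rewrite invr_gt0; case/andP: q_range. Qed.

Let s_ge1 : 1 <= s.
Proof. by case/andP: q_range => ? ?; rewrite invf_ge1// ltW. Qed.

Let gamma_gt0 : 0 < gamma.
Proof. by rewrite mulr_gt0 ?exprn_gt0// lt_max normc_gt0 c_neq0. Qed.

Let gamma_ge_in : normc c <= gamma.
Proof.
rewrite -[leLHS]mulr1 /gamma; apply: ler_pM => //; first exact: normc_ge0.
  by rewrite le_max lexx.
exact: exprn_ege1.
Qed.

Let gamma_ge_out : (normc c)^-1 * s ^+ 2 <= gamma.
Proof.
by apply: ler_wpM2r; [rewrite exprn_ge0// ltW|rewrite le_max lexx orbT].
Qed.

Lemma theta_zero_orbit z (n : int) : z != 0 -> f z = 0 -> f (q ^ n * z) = 0.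
Proof.
have in_orbit m w : w != 0 -> f w = 0 -> f (q ^+ m * w) = 0.
  move=> w0 fw; elim: m => [|m ih]; first by rewrite expr0 mul1r.
  by rewrite exprS -mulrA f_eq ?ih ?mulr0// mulf_neq0// expf_neq0.
have out_orbit m w : w != 0 -> f (q ^+ m * w) = 0 -> f w = 0.
  move=> w0; elim: m => [|m ih]; first by rewrite expr0 mul1r.
  have qw : q ^+ m * w != 0 by rewrite mulf_neq0// expf_neq0.
  rewrite exprS -mulrA f_eq// => /eqP; rewrite mulf_eq0 => /orP[|/eqP//].
  by rewrite mulf_eq0 (negPf c_neq0) invr_eq0 expf_eq0 (negPf qw) andbF.
move=> z0 fz; case: n => n; first exact: in_orbit.
change (q ^ Negz n) with (q ^- n.+1); apply: (out_orbit n.+1).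
  by rewrite mulf_neq0// invr_eq0 expf_neq0.
by rewrite mulrA divff ?expf_neq0// mul1r.
Qed.

(** Starting from the unit circle, step [i] of the functional equation, inwards or outwards,
    multiplies the bound by [gamma * s ^+ (2 * i)]. Up to factors exponential in [j] this is
    |q|^(-j^2). *)
Lemma theta_growth (B : R) (j : nat) z : (forall w, normc w = 1 -> normc (f w) <= B) ->
  normc z = t ^+ j \/ normc z = s ^+ j ->
  normc (f z) <= B * \prod_(i < j) (gamma * s ^+ (2 * i)).
Proof.
move=> fB; have t0 : t != 0 by rewrite normc_eq0.
have := s_gt0; move=> /ltW s_ge0.
elim: j z => [|j ih] z; first by rewrite !expr0 big_ord0 mulr1 => -[] /fB.
rewrite big_ord_recr /= [B * _]mulrA; case=> zj.
- pose w := z / q.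
  have wn : normc w = t ^+ j by rewrite Normc.normcM Normc.normcV zj exprSr mulfK.
  have w0 : w != 0 by rewrite -normc_gt0 wn exprn_gt0//; case/andP: q_range.
  have -> : z = q * w by rewrite mulrC divfK.
  rewrite f_eq// Normc.normcM mulrC; apply: ler_pM; rewrite ?normc_ge0//.
    by apply: ih; left.
  rewrite Normc.normcM Normc.normcV normcX wn -exprM -exprVn [(j * 2)%N]mulnC.
  by apply: ler_wpM2r => //; rewrite exprn_ge0.
- have z0 : z != 0 by rewrite -normc_gt0 zj exprn_gt0.
  have -> : f z = z ^+ 2 / c * f (q * z).
    by rewrite f_eq//; field; rewrite z0.
  rewrite Normc.normcM mulrC; apply: ler_pM; rewrite ?normc_ge0//.
    by apply: ih; right; rewrite Normc.normcM zj exprS mulrA divff// mul1r.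
  rewrite Normc.normcM Normc.normcV normcX zj -exprM mulSn exprD [(2 * j)%N]mulnC mulrC mulrA.
  by apply: ler_wpM2r => //; rewrite exprn_ge0.
Qed.

Variable a : 'I_3 -> C.
Hypothesis a_neq0 : forall i, a i != 0.
Hypothesis f_a : forall i, f (a i) = 0.
Hypothesis a_incongruent :
  forall (i j : 'I_3) (n : int), a i = q ^ n * a j -> i = j.

Local Notation idx N := ('I_3 * ('I_N * bool))%type.

(** The successor leaves out the exponent 0. The flag [true] marks the points moving towards
    infinity, whose factors have the form [1 - z / p]. *)
Let expo N (k : idx N) : int :=
  if k.2.2 then - (k.2.1.+1)%:Z else (k.2.1.+1)%:Z.

Let pt N (k : idx N) : C := q ^ expo k * a k.1.

Let pt_neq0 N (k : idx N) : pt k != 0.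
Proof. by rewrite mulf_neq0// expfz_neq0. Qed.

Let theta_trunc N (z : C^o) : C^o := \prod_(k : idx N) zfactor k.2.2 (pt k) z.

Let q_exp_inj (m n : int) : q ^ m = q ^ n -> m = n.
Proof.
case/andP: q_range => h0 h1.
have norm1 k : q ^+ k = 1 -> k = 0%N.
  move=> /(congr1 normc); rewrite normcX Normc.normc1.
  by case: k => // k /eqP; rewrite pexpr_eq1 ?normc_ge0// lt_eqF.
move=> E; apply/eqP; rewrite -subr_eq0; apply/eqP.
have : q ^ (m - n) = 1.
  apply: (mulIf (_ : q ^ n != 0)); first by rewrite expfz_neq0.
  by rewrite -expfzDr// subrK mul1r.
case: (m - n) => k; first by move/norm1 => ->.
by move=> /eqP; rewrite invr_eq1 => /eqP/norm1.
Qed.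

Let pt_inj N : injective (@pt N).
Proof.
move=> k l; rewrite /pt => E.
have kl : k.1 = l.1.
  apply: (a_incongruent (n := expo l - expo k)).
  have qk : q ^ expo k != 0 by rewrite expfz_neq0.
  by apply: (mulfI qk); rewrite E mulrA -expfzDr// addrC subrK.
move: E; rewrite kl => /(mulIf (a_neq0 _))/q_exp_inj.
move: kl; rewrite /expo; case: k l => [i [m b]] [j [n d]] /= -> E.
by congr (_, _); case: b d E => -[] //= E; congr (_, _); apply: val_inj; move: E => /=; clear; lia.
Qed.

Let t_gt0 : 0 < t.
Proof. by case/andP: q_range. Qed.

(** The modulus of the term that [zfactor] subtracts from 1. *)
Let zratio (b : bool) (p z : C) : R :=
  if b then normc z / normc p else normc p / normc z.

Let normc_zfactor_ge b p z :
  zratio b p z - 1 <= normc (zfactor b p z) /\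
  1 - zratio b p z <= normc (zfactor b p z).
Proof.
rewrite /zfactor /zratio; case: b; rewrite -Normc.normcV -Normc.normcM; split.
- by have := normc_ge_sub (z / p) 1; rewrite Normc.normc1.
- by have := normc_ge_sub 1 (z / p); rewrite Normc.normc1 -[z / p - 1]opprB normcN.
- by have := normc_ge_sub (p / z) 1; rewrite Normc.normc1.
- by have := normc_ge_sub 1 (p / z); rewrite Normc.normc1 -[p / z - 1]opprB normcN.
Qed.

Let normc_zfactor_le b p z : normc (zfactor b p z) <= 1 + zratio b p z.
Proof.
rewrite /zfactor /zratio; case: b; rewrite -Normc.normcV -Normc.normcM;
  by apply: le_trans (le_normcD _ _) _; rewrite normcN Normc.normc1.
Qed.

Let normc_pt N (k : idx N) : normc (pt k) =
  (if k.2.2 then s else t) ^+ k.2.1.+1 * normc (a k.1).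
Proof.
rewrite /pt /expo Normc.normcM; congr (_ * _); case: k.2.2.
  by rewrite -exprnN Normc.normcV normcX exprVn.
by rewrite -normcX.
Qed.

Let t_le1 : t <= 1.
Proof. by case/andP: q_range => _ /ltW. Qed.

Let st n : s ^+ n * t ^+ n = 1.
Proof. by rewrite -exprMn mulVf ?expr1n// gt_eqF. Qed.

Let D (z : C) : R :=
  1 + \sum_(i < 3) (normc z / normc (a i) + normc (a i) / normc z).

(** For fixed [z] every factor is at most [D z], independently of [N], since positive powers of [q]
    have modulus at most 1; the growth in [N] is thus only exponential. *)
Lemma theta_trunc_le N z : normc (theta_trunc N z) <= D z ^+ (3 * (N * 2)).
Proof.
rewrite normc_prod.
have -> : D z ^+ (3 * (N * 2)) = \prod_(k : idx N) D z.
  by rewrite prodr_const !card_prod !card_ord card_bool.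
apply: ler_prod => k _; rewrite normc_ge0 /=.
apply: le_trans (normc_zfactor_le _ _ _) _; rewrite lerD2l.
have ge0 i : 0 <= normc z / normc (a i) /\ 0 <= normc (a i) / normc z.
  by rewrite !divr_ge0 ?normc_ge0.
apply: (@le_trans _ _ (normc z / normc (a k.1) + normc (a k.1) / normc z)).
  have [h1 h2] := ge0 k.1; have tn : t ^+ k.2.1.+1 <= 1 by rewrite exprn_ile1// ltW.
  rewrite /zratio normc_pt; case: (k.2.2).
    rewrite invfM mulrCA -exprVn invrK; have := ler_wpM2r h1 tn; lra.
  rewrite -mulrA; have := ler_wpM2r h2 tn; lra.
rewrite (bigD1 k.1)//= lerDl sumr_ge0// => i _.
by have [h1 h2] := ge0 i; rewrite addr_ge0.
Qed.

(** Lower bounds for the factors on a large circle ([b] true) or a small one ([b] false): the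
    factors flagged [b] grow, the others stay near 1. *)
Let lam N (b : bool) (k : idx N) : R :=
  if k.2.2 == b then s ^+ (N - k.2.1.+1) else 2^-1.

Let lam_gt0 N b (k : idx N) : 0 < lam b k.
Proof. by rewrite /lam; case: ifP; rewrite ?exprn_gt0// invr_gt0. Qed.

Let prod_lam N b : \prod_(k : idx N) lam b k =
  (\prod_(i < N) (s ^+ i / 2)) ^+ 3.
Proof.
rewrite -(pair_bigA _ (fun (i : 'I_3) (x : 'I_N * bool) =>
   if x.2 == b then s ^+ (N - x.1.+1) else 2^-1)) /=.
rewrite prodr_const card_ord; congr (_ ^+ 3).
rewrite -(pair_bigA _ (fun (n : 'I_N) (d : bool) =>
   if d == b then s ^+ (N - n.+1) else 2^-1)) /=.
rewrite (reindex_inj rev_ord_inj); apply: eq_bigr => n _ /=.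
rewrite big_bool; have -> : (N - (N - n.+1).+1 = n)%N by rewrite subnSK// subKn// ltnW.
by case: b => /=; rewrite // mulrC.
Qed.

(** The margin [m] absorbs the sizes of the [a i]. For the growing kind the ratio is at least 2 S
    with S >= 1 the claimed bound, and 2 S - 1 >= S; for the other kind it is at most 1/2. *)
Let zfactor_lower N m (k : idx N) z b :
  (forall i, 2 * normc (a i) <= s ^+ m /\ 2 <= s ^+ m * normc (a i)) ->
  normc z = (if b then s else t) ^+ (N + m) ->
  lam b k <= normc (zfactor k.2.2 (pt k) z).
Proof.
move=> hm zn; have [g1 g2] := normc_zfactor_ge k.2.2 (pt k) z.
have [m1 m2] := hm k.1; set al := normc (a k.1) in m1 m2.
have al0 : 0 < al by rewrite normc_gt0.
have NE : (N + m = (N - k.2.1.+1) + (k.2.1.+1 + m))%N by rewrite addnA subnK.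
set S := s ^+ (N - k.2.1.+1); have S1 : 1 <= S by exact: exprn_ege1.
have small : t ^+ (N + m) * t ^+ k.2.1.+1 <= t ^+ m.
  rewrite exprD mulrAC -[leRHS]mul1r; apply: ler_wpM2r; first by rewrite exprn_ge0// ltW.
  by rewrite mulr_ile1// ?exprn_ge0 ?exprn_ile1// ltW.
have tm0 : 0 <= t ^+ m by rewrite exprn_ge0// ltW.
have ts : t ^+ m * s ^+ m = 1 by rewrite mulrC.
have tm1 : t ^+ m <= al / 2.
  by rewrite ler_pdivlMr//; have := ler_wpM2l tm0 m2; rewrite mulrA ts mul1r.
have tm2 : t ^+ m * al <= 2^-1.
  by have := ler_wpM2l tm0 m1; rewrite ts; lra.
have [kb|kb] := eqVneq k.2.2 b.
- rewrite /lam kb eqxx -/S; suff big : 2 * S <= zratio b (pt k) z.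
    by rewrite kb in g1; apply: le_trans g1; lra.
  have -> : zratio b (pt k) z = (if b then s ^+ m / al else s ^+ m * al) * S.
    rewrite /zratio normc_pt kb zn -/al NE /S; case: (b);
      rewrite !exprD ?exprVn; field; rewrite ?expf_neq0 ?gt_eqF//.
  apply: ler_wpM2r; first by lra.
  by case: (b) => //; rewrite ler_pdivlMr.
- rewrite /lam (negPf kb); suff sm : zratio k.2.2 (pt k) z <= 2^-1.
    by apply: le_trans g2; lra.
  rewrite /zratio normc_pt zn -/al; case: k.2.2 b kb {zn g1 g2} => -[] //= _.
    rewrite invfM -[(s ^+ _)^-1]exprVn invrK mulrA ler_pdivrMr//.
    by rewrite [_ * al]mulrC; exact: le_trans tm1.
  rewrite -exprVn invrK mulrAC [_ * t ^+ (N + m)]mulrC.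
  by apply: le_trans tm2; apply: ler_wpM2r small; exact: ltW.
Qed.

Let exists_scale (r : R) : 0 < r -> exists n0, forall n, (n0 <= n)%N ->
  t ^+ n <= r <= s ^+ n.
Proof.
move=> r0; have [n1 h1] := expr_lt_exists q_range r0.
have [|n2 h2] := expr_lt_exists q_range (_ : 0 < r^-1); first by rewrite invr_gt0.
exists (maxn n1 n2) => n; rewrite geq_max => /andP[n1n n2n].
apply/andP; split.
  by apply: le_trans (ltW h1); rewrite ler_wiXn2l// ltW.
rewrite -[r]invrK exprVn lef_pV2 ?posrE ?invr_gt0 ?exprn_gt0//.
by apply: le_trans (ltW h2); rewrite ler_wiXn2l// ltW.
Qed.

Lemma theta_three_zeros_eq0 z : z != 0 -> f z = 0.
Proof.
move=> z0; have fc w : w != 0 -> {for w, continuous f}.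
  by move=> /f_derivable; exact: derivable_continuous.
have [B B0 fB] := bounded_on_unit_circle fc.
have [m hm] : exists m, forall i, 2 * normc (a i) <= s ^+ m /\
    2 <= s ^+ m * normc (a i).
  have /choice[n0 hn0] : forall i, exists n0, forall n, (n0 <= n)%N ->
      2 * normc (a i) <= s ^+ n /\ 2 <= s ^+ n * normc (a i).
    move=> i; have ai : 0 < normc (a i) by rewrite normc_gt0.
    have [|n1 h1] := exists_scale (_ : 0 < 2 * normc (a i)); first by rewrite mulr_gt0.
    have [|n2 h2] := exists_scale (_ : 0 < 2 / normc (a i)); first by rewrite divr_gt0.
    exists (maxn n1 n2) => n; rewrite geq_max => /andP[/h1/andP[_ ?] /h2/andP[_]].
    by rewrite ler_pdivrMr.
  exists (\max_i n0 i) => i; apply: hn0; exact: leq_bigmax.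
have [|n1 hn1] := exists_scale (_ : 0 < normc z); first by rewrite normc_gt0.
(* On the two boundary circles [F] bounds [f] from above and [Lam] bounds the truncated product from
   below; the shift by [m] puts the circles beyond all zeros of that product. *)
pose F N : R := B * \prod_(i < N + m) (gamma * s ^+ (2 * i)).
pose Lam N : R := (\prod_(i < N) (s ^+ i / 2)) ^+ 3.
have Lam0 N : 0 < Lam N.
  by rewrite exprn_gt0// prodr_gt0// => i _; rewrite divr_gt0// exprn_gt0.
have F0 N : 0 < F N.
  by rewrite mulr_gt0// prodr_gt0// => i _; rewrite mulr_gt0// exprn_gt0.
have D0 : 0 < D z.
  by rewrite ltr_pwDl// sumr_ge0// => i _; rewrite addr_ge0// divr_ge0 ?normc_ge0.
have bound N : (n1 <= N)%N ->
    normc (f z) <= F N / Lam N * D z ^+ (3 * (N * 2)).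
  move=> n1N; apply: (@le_trans _ _ (F N / Lam N * normc (theta_trunc N z))).
    apply: (@max_principle_quotient R f (theta_trunc N) (t ^+ (N + m)) (s ^+ (N + m))).
    - by rewrite exprn_gt0.
    - exact: f_derivable.
    - move=> w w0; have [] // := @prod_zfactor_simple R (idx N) (index_enum _)
        (fun k => k.2.2) (@pt N) w (index_enum_uniq _) (@pt_inj N) (@pt_neq0 N) w0.
    - move=> w w0 Tw; have [_ /(_ Tw) DT] := @prod_zfactor_simple R (idx N) (index_enum _)
        (fun k => k.2.2) (@pt N) w (index_enum_uniq _) (@pt_inj N) (@pt_neq0 N) w0.
      split=> //; move: Tw => /eqP/prodf_eq0[k _].
      by rewrite zfactor_eq0// => /eqP ->; rewrite theta_zero_orbit.
    - move=> w hw.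
      have wgt0 : 0 < normc w by case: hw => ->; rewrite exprn_gt0.
      have LT : Lam N <= normc (theta_trunc N w).
        rewrite normc_prod.
        have [b wb] : exists b : bool, normc w = (if b then s else t) ^+ (N + m).
          by case: hw => ->; [exists false|exists true].
        rewrite /Lam -(prod_lam N b); apply: ler_prod => k _.
        by rewrite ltW//=; exact: zfactor_lower hm wb.
      split; first by rewrite -normc_gt0; exact: lt_le_trans LT.
      apply: le_trans (theta_growth fB hw) _; rewrite -/(F N).
      by rewrite mulrAC ler_pdivlMr// ler_pM2l.
    - by apply: hn1; exact: leq_trans (leq_addr _ _).
  by apply: ler_wpM2l (theta_trunc_le _ _); rewrite divr_ge0 ?ltW.
(* [E * t ^+ N] is the ratio of consecutive bounds: [F] gains [gamma * s ^+ (2 * (N + m))], [Lam]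
   gains [s ^+ (3 * N) / 8], and six more factors are bounded by [D z]. *)
pose E := gamma * s ^+ (2 * m) * D z ^+ 6 * 8.
have E0 : 0 < E.
  apply: mulr_gt0 => //; apply: mulr_gt0; last exact: exprn_gt0.
  by apply: mulr_gt0; [exact: gamma_gt0|exact: exprn_gt0].
have geom N : F N / Lam N * D z ^+ (3 * (N * 2)) =
    F 0%N * \prod_(i < N) (E * t ^+ i).
  elim: N => [|N ih]; first by rewrite /Lam !big_ord0 expr1n invr1 !mulr1.
  rewrite big_ord_recr /= [F 0%N * _]mulrA -ih /F /Lam addSn !big_ord_recr /= -/(F N).
  set p := \prod_(i < N) _; have p0 : p != 0.
    by rewrite gt_eqF// prodr_gt0// => i _; rewrite divr_gt0// exprn_gt0.
  have -> : (3 * (N.+1 * 2) = 3 * (N * 2) + 6)%N by rewrite [(N.+1 * 2)%N]mulSn mulnDr addnC.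
  rewrite /E [in RHS]/F; set P := \prod_(i < N + m) _.
  have -> : s ^+ (2 * (N + m)) = s ^+ (2 * m) * (s ^+ N) ^+ 2.
    by rewrite mulnDr exprD mulrC -exprM [(N * 2)%N]mulnC.
  have -> : t ^+ N = (s ^+ N)^-1 by rewrite -exprVn invrK.
  have sN : s ^+ N != 0 by rewrite gt_eqF// exprn_gt0.
  rewrite (exprD (D z)); move: (s ^+ N) sN (s ^+ (2 * m)) => x x0 y.
  field.
  by rewrite x0 p0.
apply/eqP; rewrite -normc_eq0 eq_le normc_ge0 andbT; apply/ler_addgt0Pl => e e0.
have [|N n1N hN] := @prod_geometric_small R t E (e / F 0%N) n1 q_range E0.
  by rewrite divr_gt0.
rewrite addr0; apply: le_trans (bound N n1N) _.
by rewrite geom mulrC -ler_pdivlMr// ltW.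
Qed.

End ThreeZeros.
End Theta.

(** * Matrices of holomorphic functions *)

Lemma derivable_mul2D (K : numFieldType) (f1 g1 f2 g2 : K^o -> K^o) (z : K^o) :
  derivable f1 z 1 -> derivable g1 z 1 -> derivable f2 z 1 -> derivable g2 z 1 ->
  derivable (fun w : K^o => f1 w * g1 w + f2 w * g2 w : K^o) z 1.
Proof.
by move=> d1 d2 d3 d4; exact: (derivableD (derivableM d1 d2) (derivableM d3 d4)).
Qed.

Lemma derivable_mul2B (K : numFieldType) (f1 g1 f2 g2 : K^o -> K^o) (z : K^o) :
  derivable f1 z 1 -> derivable g1 z 1 -> derivable f2 z 1 -> derivable g2 z 1 ->
  derivable (fun w : K^o => f1 w * g1 w - f2 w * g2 w : K^o) z 1.
Proof.
by move=> d1 d2 d3 d4; exact: (derivableB (derivableM d1 d2) (derivableM d3 d4)).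
Qed.

Lemma derivable_div (K : numFieldType) (f g : K^o -> K^o) (z : K^o) :
  derivable f z 1 -> derivable g z 1 -> g z != 0 ->
  derivable (fun w : K^o => f w * (g w)^-1 : K^o) z 1.
Proof. by move=> df dg gz; exact: (derivableM df (derivableV gz dg)). Qed.

Lemma ord2 (i : 'I_2) : i = 0 \/ i = 1.
Proof. by case: i => -[|[|//]] h; [left|right]; apply: val_inj. Qed.

Section MatrixFunctions.
Context {R : realType}.
Local Notation C := R[i].
Implicit Types (z w : C).

Local Notation normc := (@Normc.normc R).

Definition mx_derivable (A : C -> 'M[C]_2) (z : C) :=
  forall i j, derivable ((fun w => A w i j) : C^o -> C^o) z 1.

Lemma det2E (A : 'M[C]_2) : \det A = A 0 0 * A 1 1 - A 0 1 * A 1 0.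
Proof.
rewrite (expand_det_row _ 0) !big_ord_recl big_ord0 /cofactor !det_mx11 !mxE /=.
rewrite !addn0 addn1 expr0 expr1 mul1r mulN1r mulrN addr0.
have -> : lift ord0 ord0 = 1 :> 'I_2 by apply: val_inj.
by have -> : lift (1 : 'I_2) (0 : 'I_1) = 0 :> 'I_2 by apply: val_inj.
Qed.

Lemma mulmx2E (A B : 'M[C]_2) i j : (A *m B) i j = A i 0 * B 0 j + A i 1 * B 1 j.
Proof.
rewrite mxE !big_ord_recl big_ord0 addr0.
by have -> : lift ord0 ord0 = 1 :> 'I_2 by apply: val_inj.
Qed.

Lemma mx_derivable_mul (A B : C -> 'M[C]_2) z :
  mx_derivable A z -> mx_derivable B z -> mx_derivable (fun w => A w *m B w) z.
Proof.
move=> dA dB i j.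
have -> : (fun w => (A w *m B w) i j) =
    (fun w => A w i 0 * B w 0 j + A w i 1 * B w 1 j).
  by apply/funext => w; rewrite mulmx2E.
exact: derivable_mul2D (dA _ _) (dB _ _) (dA _ _) (dB _ _).
Qed.

Lemma det_derivable (A : C -> 'M[C]_2) z :
  mx_derivable A z -> derivable ((fun w => \det (A w)) : C^o -> C^o) z 1.
Proof.
move=> dA.
have -> : (fun w => \det (A w)) =
    (fun w => A w 0 0 * A w 1 1 - A w 0 1 * A w 1 0).
  by apply/funext => w; rewrite det2E.
exact: derivable_mul2B.
Qed.

Lemma mx_derivable_near (A B : C -> 'M[C]_2) z (d : R) : 0 < d ->
  (forall w, normc (w - z) < d -> A w = B w) ->
  mx_derivable A z -> mx_derivable B z.
Proof.
move=> d0 AB dA i j; apply: near_derivable d0 _ (dA i j) => w /AB.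
by move=> ->.
Qed.

Lemma det_neq0_near (A : C -> 'M[C]_2) z : mx_derivable A z -> \det (A z) != 0 ->
  exists2 d : R, 0 < d & forall w, normc (w - z) < d -> \det (A w) != 0.
Proof.
move=> /det_derivable/derivable_continuous cA Az.
exact: nbhs_neq0 cA Az.
Qed.

(** The position (1 - j, 1 - i), whose entry is up to sign the entry (i, j) of the adjugate. *)
Let cross (i j : 'I_2) : 'I_2 * 'I_2 := (if j == 0 then 1 else 0, if i == 0 then 1 else 0).

Lemma invmx2E (A : 'M[C]_2) i j : \det A != 0 ->
  invmx A i j = (-1) ^+ (i != j) * A (cross i j).1 (cross i j).2 * (\det A)^-1.
Proof.
move=> dA; have uA : A \in unitmx by rewrite unitmxE unitfE.
pose B : 'M[C]_2 := \matrix_(i, j)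
  ((-1) ^+ (i != j) * A (cross i j).1 (cross i j).2 * (\det A)^-1).
suff -> : invmx A = B by rewrite mxE.
suff AB : A *m B = 1%:M by rewrite -[B](mulKmx uA) AB mulmx1.
apply/matrixP => k l; rewrite mulmx2E !mxE.
case: (ord2 k) => ->; case: (ord2 l) => -> /=;
  rewrite ?expr0 ?expr1 ?mulr1n ?mulr0n; rewrite det2E in dA *; field; exact: dA.
Qed.

Lemma mx_derivable_inv (A : C -> 'M[C]_2) z : mx_derivable A z ->
  \det (A z) != 0 -> mx_derivable (fun w => invmx (A w)) z.
Proof.
move=> dA Az; have [d d0 hd] := det_neq0_near dA Az => i j.
pose g (w : C^o) : C^o := (-1) ^+ (i != j) * A w (cross i j).1 (cross i j).2.
(* [invmx] follows the cofactor formula only where the determinant is nonzero, hence the passage to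
   a neighbourhood of [z]. *)
apply: (near_derivable d0 (f := fun w : C^o => g w * (\det (A w))^-1 : C^o)).
  by move=> w /hd Aw; rewrite invmx2E.
have dg : derivable g z 1.
  exact: (@derivableZ C C^o C^o _ ((-1) ^+ (i != j)) z 1 (dA _ _)).
exact: (@derivable_div C g (fun w => \det (A w)) z dg (det_derivable dA) Az).
Qed.

Lemma mx_derivable_scale (k : C^o -> C^o) (A : 'M[C]_2) z : derivable k z 1 ->
  mx_derivable (fun w => k w *: A) z.
Proof.
move=> dk i j; have -> : (fun w => (k w *: A) i j) = fun w => k w * A i j.
  by apply/funext => w; rewrite mxE.
have dc : derivable (cst (A i j) : C^o -> C^o) z 1 by exact: derivable_cst.
exact: (derivableM dk dc).
Qed.

End MatrixFunctions.

(** * q-orbits *)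

Section Orbits.
Context {R : realType}.
Local Notation C := R[i].
Implicit Types (z w a b : C).

Local Notation normc := (@Normc.normc R).

Variables (q : C).
Hypothesis q_range : 0 < normc q < 1.

Let q_neq0 : q != 0.
Proof. by rewrite -normc_gt0; case/andP: q_range. Qed.

Lemma qpowerV a : qpower q a -> qpower q a^-1.
Proof. by move=> [n ->]; exists (- n); rewrite -invr_expz. Qed.

Lemma qpowerM a b : qpower q a -> qpower q b -> qpower q (a * b).
Proof. by move=> [m ->] [n ->]; exists (m + n); rewrite expfzDr. Qed.

Lemma qpower_trans a b z : z != 0 -> qpower q (z / a) -> qpower q (z / b) ->
  qpower q (a / b).
Proof.
move=> z0 /qpowerV za zb; have := qpowerM za zb.
by rewrite invf_div mulrA divfK.
Qed.

Lemma qpower_norm1 (r : R) : normc q < r -> r < (normc q)^-1 ->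
  qpower q r%:C -> r = 1.
Proof.
move=> qr rq [n E]; have /andP[t0 t1] := q_range.
have r0 : 0 < r by exact: lt_trans qr.
have : normc r%:C = r by rewrite /= expr0n /= addr0 sqrtr_sqr gtr0_norm.
rewrite E; case: n {E} => n.
  rewrite normcX; case: n => [|n] Er; first by rewrite -Er expr0.
  move: qr; rewrite -Er exprS ltNge -[X in _ <= X]mulr1 ler_wpM2l ?normc_ge0//.
  by rewrite exprn_ile1// ltW.
change (q ^ Negz n) with (q ^- n.+1); rewrite Normc.normcV normcX => Er.
move: rq; rewrite -Er ltNge lef_pV2 ?posrE ?exprn_gt0// exprS.
by rewrite -[X in _ <= X]mulr1 ler_wpM2l ?normc_ge0// exprn_ile1// ltW.
Qed.

(* Three points of the ray through z, closer to each other than the ratio |q|,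
   lie in pairwise distinct orbits, so one of them avoids both given orbits. *)
Lemma exists_off_orbits z a b (d : R) : z != 0 -> 0 < d ->
  exists w, [/\ w != 0, normc (w - z) < d, ~ qpower q (w / a) & ~ qpower q (w / b)].
Proof.
move=> z0 d0; have /andP[t0 t1] := q_range; have zn : 0 < normc z by rewrite normc_gt0.
have s1 : 1 < (normc q)^-1 by rewrite invf_gt1.
pose e := Num.min (d / normc z) ((normc q)^-1 - 1).
have e0 : 0 < e by rewrite lt_min divr_gt0// subr_gt0.
have ed : normc z * e <= d by rewrite mulrC -ler_pdivlMr// ge_min lexx.
have es : e <= (normc q)^-1 - 1 by rewrite ge_min lexx orbT.
clearbody e.
(* Dividing by [k.+2] rather than [k.+1] keeps [r k - 1] strictly below [e]. *)
pose r (k : nat) : R := 1 + e / k.+2%:R.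
have r1 k : 1 < r k by rewrite ltrDl divr_gt0.
have re k : r k <= 1 + e / 2.
  by rewrite lerD2l ler_pM2l// lef_pV2 ?posrE// ler_nat.
have rs k : r k < (normc q)^-1.
  by apply: le_lt_trans (re k) _; lra.
have rinj k l : r k = r l -> k = l.
  move=> /addrI/(mulfI (negbT (gt_eqF e0)))/invr_inj/eqP.
  by rewrite eqr_nat => /eqP[].
pose p k : C := (r k)%:C * z.
have rC k : (r k)%:C != 0 by rewrite (inj_eq (@complexI R)) gt_eqF// (lt_trans _ (r1 k)).
have p0 k : p k != 0 by rewrite mulf_neq0.
have pd k : normc (p k - z) < d.
  have -> : p k - z = (r k - 1)%:C * z by rewrite rmorphB rmorph1 mulrBl mul1r.
  rewrite Normc.normcM /= expr0n /= addr0 sqrtr_sqr gtr0_norm ?subr_gt0//.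
  apply: lt_le_trans ed; rewrite mulrC ltr_pM2l//.
  by have := re k; lra.
have sep k l c : qpower q (p k / c) -> qpower q (p l / c) -> k = l.
  move=> h1 /qpowerV h2; apply: rinj; have := qpowerM h1 h2.
  (* Division by 0 yields 0, which is not a power of [q]. *)
  have [c0|c0] := eqVneq c 0.
    move: h1; rewrite c0 invr0 mulr0 => -[n /esym/eqP].
    by rewrite expfz_eq0 (negPf q_neq0) andbF.
  (* The ratio of two numbers in (1, 1/|q|) lies strictly between |q| and 1/|q|; a power of [q]
     there is 1. *)
  rewrite invf_div mulrA divfK// /p -mulf_div divff// mulr1 -fmorph_div.
  move=> /qpower_norm1 H; apply/eqP; rewrite -[r k](divfK (negbT (gt_eqF (lt_trans ltr01 (r1 l))))).
  rewrite H ?mul1r//.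
    rewrite ltr_pdivlMr ?(lt_trans ltr01)//; apply: lt_trans (r1 k).
    by rewrite -[ltRHS](mulfV (negbT (gt_eqF t0))) ltr_pM2l.
  rewrite ltr_pdivrMr ?(lt_trans ltr01)//; apply: lt_trans (rs k) _.
  by rewrite -[ltLHS]mulr1 ltr_pM2l// invr_gt0.
apply: contrapT => H.
have cover k : qpower q (p k / a) \/ qpower q (p k / b).
  apply: contrapT => nk; apply: H; exists (p k); split => // h; apply: nk; [left|right]; exact: h.
case: (cover 0%N) (cover 1%N) (cover 2%N) => [h0|h0] [h1|h1] [h2|h2].
- by have := sep _ _ _ h0 h1.
- by have := sep _ _ _ h0 h1.
- by have := sep _ _ _ h0 h2.
- by have := sep _ _ _ h1 h2.
- by have := sep _ _ _ h1 h2.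
- by have := sep _ _ _ h0 h2.
- by have := sep _ _ _ h0 h1.
- by have := sep _ _ _ h0 h1.
Qed.

(** Points off the two orbits accumulate at [z], where the difference is continuous. *)
Lemma eq_off_orbits (f g : C^o -> C^o) a b z : z != 0 ->
  derivable f z 1 -> derivable g z 1 ->
  (forall w, w != 0 -> ~ qpower q (w / a) -> ~ qpower q (w / b) -> f w = g w) ->
  f z = g z.
Proof.
move=> z0 df dg fg; apply/eqP; rewrite -subr_eq0; apply: contraT => fgz.
have [d d0 hd] := nbhs_neq0 (derivable_continuous (derivableB df dg)) fgz.
have [w [w0 wz wa wb]] := exists_off_orbits a b z0 d0.
by have := hd w wz; rewrite -[(f - g) w]/(f w - g w) fg// subrr eqxx.
Qed.

(** A zero off both orbits would be a third incongruent one and force [f] to vanish identically on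
    C^*. *)
Lemma theta_two_zeros (c : C) (f : C^o -> C^o) a b : c != 0 ->
  (forall z, z != 0 -> derivable f z 1) ->
  (forall z, z != 0 -> f (q * z) = c * z ^- 2 * f z) ->
  a != 0 -> b != 0 -> ~ qpower q (a / b) -> f a = 0 -> f b = 0 ->
  (exists2 z, z != 0 & f z != 0) ->
  forall z, z != 0 -> f z = 0 <-> qpower q (z / a) \/ qpower q (z / b).
Proof.
move=> c0 df feq a0 b0 ab fa fb [z1 z10 fz1] z z0; split; last first.
  have orb u : u != 0 -> f u = 0 -> qpower q (z / u) -> f z = 0.
    move=> u0 fu [n E]; have -> : z = q ^ n * u by rewrite -E divfK.
    exact: (theta_zero_orbit q_range c0 feq).
  by move=> [] /orb; apply.
move=> fz; apply: contrapT => nz.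
have za : ~ qpower q (z / a) by move=> h; apply: nz; left.
have zb : ~ qpower q (z / b) by move=> h; apply: nz; right.
pose p (i : 'I_3) := nth a [:: a; b; z] i.
have ne u v n : v != 0 -> u = q ^ n * v -> qpower q (u / v).
  by move=> v0 ->; exists n; rewrite mulfK.
suff : f z1 = 0 by move=> E; rewrite E eqxx in fz1.
apply: (@theta_three_zeros_eq0 R q c f q_range c0 df feq p) => //.
- by case=> [[|[|[|//]]] ?].
- by case=> [[|[|[|//]]] ?].
- have sw u v : ~ qpower q (u / v) -> ~ qpower q (v / u).
    by move=> h /qpowerV; rewrite invf_div.
  move=> [[|[|[|//]]] ?] [[|[|[|//]]] ?] n /= E; apply: val_inj => //=; exfalso.
  + by apply: ab; exact: ne E.
  + by apply: (sw _ _ za); exact: ne E.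
  + by apply: (sw _ _ ab); exact: ne E.
  + by apply: (sw _ _ zb); exact: ne E.
  + by apply: za; exact: ne E.
  + by apply: zb; exact: ne E.
Qed.

End Orbits.

(** * Mano decompositions *)

Section Mano.
Context {R : realType}.
Local Notation C := R[i].
Implicit Types (z w : C).

Local Notation normc := (@Normc.normc R).

Lemma diag2_unit (d : 'I_2 -> C) : (forall i, d i != 0) -> diag2 d \in unitmx.
Proof.
move=> d0; rewrite unitmxE det_diag unitfE; apply/prodf_neq0 => i _.
by rewrite mxE.
Qed.

Lemma unitmx_det (A : 'M[C]_2) : (A \in unitmx) = (\det A != 0).
Proof. by rewrite unitmxE unitfE. Qed.

Lemma unitmx_scale (A : 'M[C]_2) z : z != 0 -> A \in unitmx -> z *: A \in unitmx.
Proof. by move=> z0 uA; rewrite unitmxZ// unitfE. Qed.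

Lemma derivable_scaled_arg (f : C -> C) (q z : C) : derivable (f : C^o -> C^o) (q * z) 1 ->
  derivable ((fun w => f (q * w)) : C^o -> C^o) z 1.
Proof.
move=> df; have dq : derivable ((fun w => q * w) : C^o -> C^o) z 1.
  exact: (@derivableZ C C^o C^o id q z 1 (@derivable_id C C^o z 1)).
exact: (derivable_compose dq df).
Qed.

Variables (q : C) (rho sigma : 'I_2 -> C) (x : 'I_4 -> C).
Hypothesis q_range : 0 < `|q| < 1.
Hypothesis rho_neq0 : forall i, rho i != 0.
Hypothesis sigma_neq0 : forall i, sigma i != 0.
Hypothesis x_neq0 : forall k, x k != 0.
Hypothesis x_incongruent : forall k l : 'I_4, (k < l)%N -> ~ qpower q (x k / x l).
Variable M : C -> 'M[C]_2.
Hypothesis M_F : F_set q (diag2 rho) (diag2 sigma) x M.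

Let q_range' : 0 < normc q < 1.
Proof. by move: q_range; rewrite normrE_normc !ltcR. Qed.

Let q_neq0 : q != 0.
Proof. by rewrite -normc_gt0; case/andP: q_range'. Qed.

Let uA := diag2_unit rho_neq0.
Let uB := diag2_unit sigma_neq0.

(** * Determinants and functional equations within one decomposition *)

Section OneDecomposition.
Variables (P Q : C -> 'M[C]_2) (A : 'M[C]_2).
Hypothesis PQ : Mano_decomposition q (diag2 rho) x M P Q A.

Let uC : A \in unitmx. Proof. by case: PQ. Qed.
Let dP z : z != 0 -> mx_derivable P z.
Proof. by case: PQ => _ [+ _] _ _ _ => h z0 i j; exact: h. Qed.
Let dQ z : z != 0 -> mx_derivable Q z.
Proof. by case: PQ => _ [_ +] _ _ _ => h z0 i j; exact: h. Qed.
Let MPQ z : z != 0 -> M z = P z *m Q z.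
Proof. by case: PQ => _ _ + _ _; apply. Qed.
Let P_eq z : z != 0 -> P (q * z) = diag2 rho *m P z *m invmx (z *: A).
Proof. by case: PQ => _ _ _ + _; apply. Qed.

(** The degree two comes from the size of the matrices, as [\det (z *: A) = z ^+ 2 * \det A]. *)
Lemma Mano_left_det_eq z : z != 0 -> \det (P (q * z)) =
  \det (diag2 rho) / \det A * z ^- 2 * \det (P z).
Proof.
move=> z0; rewrite P_eq// !det_mulmx det_inv detZ invfM.
by ring.
Qed.

Let det_neq0 (B : 'M[C]_2) : B \in unitmx -> \det B != 0.
Proof. by rewrite unitmx_det. Qed.

Let M_neq0 : exists2 z, z != 0 & \det (P z) != 0 /\ \det (Q z) != 0.
Proof.
case: M_F => _ _ [z z0 Mz] _; exists z => //.
by move: Mz; rewrite MPQ// det_mulmx mulf_eq0 negb_or => /andP[].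
Qed.

Lemma Mano_left_det_eq0 z : z != 0 ->
  \det (P z) = 0 <-> qpower q (z / x 0) \/ qpower q (z / x 1).
Proof.
have [P0 P1] : \det (P (x 0)) = 0 /\ \det (P (x 1)) = 0 by case: PQ.
apply: (@theta_two_zeros R q q_range' (\det (diag2 rho) / \det A) (fun z => \det (P z))) => //.
- by rewrite mulf_neq0// ?invr_eq0 det_neq0.
- by move=> w w0; apply: det_derivable; exact: dP.
- exact: Mano_left_det_eq.
- exact: x_incongruent.
- by have [w w0 [h _]] := M_neq0; exists w.
Qed.

(** Off the orbits of [x 0] and [x 1] the matrix [P] is invertible and cancels from the equations of
    [M] and [P]; continuity covers the remaining points. *)
Lemma Mano_right_eq z : z != 0 ->
  Q (q * z) = (z *: A) *m Q z *m invmx (z ^+ 2 *: diag2 sigma).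
Proof.
move=> z0; apply/matrixP => i j.
pose rhs w := (w *: A) *m Q w *m invmx (w ^+ 2 *: diag2 sigma).
have drhs : mx_derivable rhs z.
  apply: mx_derivable_mul.
    apply: mx_derivable_mul; last exact: dQ.
    by apply: mx_derivable_scale; exact: derivable_id.
  apply: mx_derivable_inv.
    by apply: mx_derivable_scale; exact: exprn_derivable.
  by rewrite -unitmx_det; apply: unitmx_scale; rewrite ?expf_neq0.
apply: (@eq_off_orbits R q q_range' (fun w : C => Q (q * w) i j) (fun w : C => rhs w i j)
  (x 0) (x 1)) => //.
  have qz0 : q * z != 0 by rewrite mulf_neq0.
  exact: (@derivable_scaled_arg (fun w => Q w i j) q z (@dQ _ qz0 i j)).
move=> w w0 wx0 wx1; congr (fun_of_matrix _ i j).
have uP : P w \in unitmx.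
  by rewrite unitmx_det; apply/eqP => /(Mano_left_det_eq0 w0) [].
have uwC := unitmx_scale w0 uC.
have qw0 : q * w != 0 by rewrite mulf_neq0.
have [_ + _ _] := M_F => /(_ w w0); rewrite /sigma_q MPQ// P_eq// MPQ// => E.
have uAP : diag2 rho *m P w \in unitmx by rewrite unitmx_mul uA.
have /(can_inj (mulKmx uAP)) {}E : diag2 rho *m P w *m (invmx (w *: A) *m Q (q * w)) =
    diag2 rho *m P w *m (Q w *m invmx (w ^+ 2 *: diag2 sigma)).
  by rewrite !mulmxA E mulmxA.
by rewrite -[LHS](mulKVmx uwC) E /rhs !mulmxA.
Qed.

(** At [x 2] and [x 3] the determinant of [M] vanishes and that of [P] does not, so [Q] is singular
    there; its functional equation leaves room for no other orbit. *)
Lemma Mano_right_det_eq0 z : z != 0 ->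
  \det (Q z) = 0 <-> qpower q (z / x 2) \/ qpower q (z / x 3).
Proof.
have Q0 (k : 'I_4) : (1 < k)%N -> \det (Q (x k)) = 0.
  move=> k1; case: M_F => _ _ _ /(_ k)/eqP.
  rewrite MPQ// det_mulmx mulf_eq0 => /orP[/eqP|/eqP//].
  move=> /(Mano_left_det_eq0 (x_neq0 k)) [] /qpowerV; rewrite invf_div.
    by move/x_incongruent; case; exact: ltnW.
  by move/x_incongruent; case.
apply: (@theta_two_zeros R q q_range' (\det A / \det (diag2 sigma)) (fun z => \det (Q z))) => //.
- by rewrite mulf_neq0// ?invr_eq0 det_neq0.
- by move=> w w0; apply: det_derivable; exact: dQ.
- move=> w w0; rewrite Mano_right_eq// !det_mulmx det_inv !detZ.
  by have h1 := det_neq0 uB; field; rewrite w0.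
- exact: x_incongruent.
- exact: Q0.
- exact: Q0.
- by have [w w0 [_ h]] := M_neq0; exists w.
Qed.

(** A common zero would place [x 0] or [x 1] in the orbit of [x 2] or [x 3]. *)
Lemma Mano_det_disjoint z : z != 0 -> \det (P z) = 0 -> \det (Q z) != 0.
Proof.
move=> z0 /(Mano_left_det_eq0 z0) hP; apply/eqP => /(Mano_right_det_eq0 z0) hQ.
by case: hP hQ => h1 [] h2;
  exact: (x_incongruent _ (qpower_trans q_range' z0 h1 h2)).
Qed.

(** The gauge relation reads [L (q * z) *m A = A' *m L z]; it carries the inverse of [L] across the
    factor in the equation of [P]. *)
Lemma Mano_gauge (L : C -> 'M[C]_2) (A' : 'M[C]_2) :
  GL_holo L -> gauge_to q L A A' ->
  Mano_decomposition q (diag2 rho) x M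
    (fun z => P z *m invmx (L z)) (fun z => L z *m Q z) A'.
Proof.
move=> [dL [B [dB LB]]] [uA' gL].
have uL z : z != 0 -> L z \in unitmx.
  by move=> z0; have [h _] := LB z z0; have [] := mulmx1_unit h.
split; first exact: uA'.
- split=> i j z z0.
    apply: (@mx_derivable_mul R P (fun w => invmx (L w)) z) => //; first exact: dP.
    apply: mx_derivable_inv; last by rewrite -unitmx_det uL.
    by move=> k l; exact: dL.
  apply: (@mx_derivable_mul R L Q z); last exact: dQ.
  by move=> k l; exact: dL.
- by move=> z z0; rewrite MPQ// mulmxA mulmxKV// uL.
- move=> z z0; have qz0 : q * z != 0 by rewrite mulf_neq0.
  rewrite /sigma_q P_eq// -!mulmxA; congr (_ *m (_ *m _)).
  have LE : L (q * z) *m A = A' *m L z.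
    by rewrite -(gL z z0) /gauge mulmxKV// uL.
  rewrite !invmxZ ?unitmx_scale// -scalemxAr -scalemxAl; congr (_ *: _).
  apply: (can_inj (mulKmx uC)); rewrite !mulmxA mulmxV// mul1mx.
  apply: (can_inj (mulKmx (uL _ qz0))); rewrite mulmxV ?uL//.
  by rewrite !mulmxA LE mulmxK ?uL// mulmxV.
- have [P0 P1] : \det (P (x 0)) = 0 /\ \det (P (x 1)) = 0 by case: PQ.
  by rewrite !det_mulmx P0 P1 !mul0r.
Qed.

End OneDecomposition.

Lemma Mano_unique (P Q P' Q' : C -> 'M[C]_2) (A A' : 'M[C]_2) :
  Mano_decomposition q (diag2 rho) x M P Q A ->
  Mano_decomposition q (diag2 rho) x M P' Q' A' ->
  exists L : C -> 'M[C]_2,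
    [/\ GL_holo L, gauge_to q L A A',
        forall z, z != 0 -> P' z = P z *m invmx (L z) &
        forall z, z != 0 -> Q' z = L z *m Q z].
Proof.
move=> D D'.
(* Two formulas for one matrix: where [P'] is singular, so is [P], and therefore [Q] is
   invertible. *)
pose L z := if \det (P' z) == 0 then Q' z *m invmx (Q z) else invmx (P' z) *m P z.
have PQE z : z != 0 -> P z *m Q z = P' z *m Q' z.
  by case: D D' => _ _ E _ _ [_ _ E' _ _] z0; rewrite -E// E'.
have dP z : z != 0 -> mx_derivable P z.
  by case: D => _ [h _] _ _ _ z0 i j; exact: h.
have dQ z : z != 0 -> mx_derivable Q z.
  by case: D => _ [_ h] _ _ _ z0 i j; exact: h.
have dP' z : z != 0 -> mx_derivable P' z.
  by case: D' => _ [h _] _ _ _ z0 i j; exact: h.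
have dQ' z : z != 0 -> mx_derivable Q' z.
  by case: D' => _ [_ h] _ _ _ z0 i j; exact: h.
have PP' z : z != 0 -> (\det (P' z) == 0) = (\det (P z) == 0).
  move=> z0; apply/eqP/eqP.
    by move/(Mano_left_det_eq0 D' z0)/(Mano_left_det_eq0 D z0).
  by move/(Mano_left_det_eq0 D z0)/(Mano_left_det_eq0 D' z0).
have LP z : \det (P' z) != 0 -> L z = invmx (P' z) *m P z.
  by rewrite /L => /negPf ->.
have LQ z : z != 0 -> \det (Q z) != 0 -> L z = Q' z *m invmx (Q z).
  move=> z0; rewrite -unitmx_det => uQ; rewrite /L; case: eqP => // /eqP.
  rewrite -unitmx_det => uP'.
  by rewrite -[P z](mulmxK uQ) PQE// -!mulmxA mulKmx.
have P'L z : z != 0 -> P' z *m L z = P z.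
  move=> z0; have [P'0|P'0] := eqVneq (\det (P' z)) 0; last first.
    by rewrite LP// mulKVmx// unitmx_det.
  have uQ : \det (Q z) != 0.
    by apply: (Mano_det_disjoint D z0); apply/eqP; rewrite -PP'// P'0.
  by rewrite LQ// mulmxA -PQE// mulmxK// unitmx_det.
have LQ' z : z != 0 -> L z *m Q z = Q' z.
  move=> z0; have [P'0|P'0] := eqVneq (\det (P' z)) 0.
    have uQ : \det (Q z) != 0.
      by apply: (Mano_det_disjoint D z0); apply/eqP; rewrite -PP'// P'0.
    by rewrite LQ// mulmxKV// unitmx_det.
  by rewrite LP// -mulmxA PQE// mulKmx// unitmx_det.
(* Where [P'] is singular, [Q' = L Q] is invertible; elsewhere [P = P' L] is. *)
have uL z : z != 0 -> L z \in unitmx.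
  move=> z0; rewrite unitmx_det; have [P'0|P'0] := eqVneq (\det (P' z)) 0.
    have := Mano_det_disjoint D' z0 P'0.
    by rewrite -LQ'// det_mulmx mulf_eq0 negb_or => /andP[].
  by have := P'0; rewrite PP'// -P'L// det_mulmx mulf_eq0 negb_or => /andP[].
have dL z : z != 0 -> mx_derivable L z.
  move=> z0; have [P'0|P'0] := eqVneq (\det (P' z)) 0; last first.
    have [d d0 hd] := det_neq0_near (dP' z z0) P'0.
    apply: (mx_derivable_near d0 (A := fun w => invmx (P' w) *m P w)).
      by move=> w /hd /LP.
    apply: mx_derivable_mul; last exact: dP.
    by apply: mx_derivable_inv => //; exact: dP'.
  (* Around a zero of [\det P'] the formula through [Q] holds on a whole neighbourhood, by
     continuity of [\det Q]; the radius [e] below keeps it away from 0. *)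
  have uQ : \det (Q z) != 0.
    by apply: (Mano_det_disjoint D z0); apply/eqP; rewrite -PP'// P'0.
  have [d d0 hd] := det_neq0_near (dQ z z0) uQ.
  have [e e0 he] := @nbhs_neq0 R id z (@cvg_id C^o (nbhs (z : C^o))) z0.
  apply: (mx_derivable_near (d := Num.min d e) (A := fun w => Q' w *m invmx (Q w))).
  - by rewrite lt_min d0.
  - by move=> w; rewrite lt_min => /andP[/hd ? /he ?]; rewrite LQ.
  - apply: mx_derivable_mul; first exact: dQ'.
    by apply: mx_derivable_inv => //; exact: dQ.
have uC : A \in unitmx by case: D.
have uC' : A' \in unitmx by case: D'.
have P_eq z : z != 0 -> P (q * z) = diag2 rho *m P z *m invmx (z *: A).
  by case: D => _ _ _ + _; apply.
have P_eq' z : z != 0 -> P' (q * z) = diag2 rho *m P' z *m invmx (z *: A').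
  by case: D' => _ _ _ + _; apply.
exists L; split.
- split; first by move=> i j z z0; exact: dL.
  exists (fun z => invmx (L z)); split.
    move=> i j z z0; apply: (mx_derivable_inv (dL z z0)).
    by rewrite -unitmx_det uL.
  by move=> z z0; rewrite mulmxV ?mulVmx ?uL.
- split; first exact: uC'.
  move=> z z0; rewrite /gauge /sigma_q.
  suff -> : L (q * z) *m A = A' *m L z by rewrite mulmxK ?uL.
  have qz0 : q * z != 0 by rewrite mulf_neq0.
  have uzC := unitmx_scale z0 uC; have uzC' := unitmx_scale z0 uC'.
  suff E : L (q * z) *m (z *: A) = (z *: A') *m L z.
    move: E; rewrite -scalemxAr -scalemxAl => /(congr1 (fun X => z^-1 *: X)).
    by rewrite !scalerA mulVf// !scale1r.
  (* At singular points of [P'] the equations of [Q] and [Q'] are compared, with [Q] invertible;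
     elsewhere those of [P] and [P']. *)
  have [P'0|P'0] := eqVneq (\det (P' z)) 0.
    have uQ : Q z \in unitmx.
      rewrite unitmx_det.
      by apply: (Mano_det_disjoint D z0); apply/eqP; rewrite -PP'// P'0.
    have uS : z ^+ 2 *: diag2 sigma \in unitmx by rewrite unitmx_scale// expf_neq0.
    have := LQ' _ qz0; rewrite (Mano_right_eq D)// (Mano_right_eq D')// -LQ'//.
    rewrite !mulmxA => /(can_inj (mulmxK (_ : invmx _ \in unitmx))).
    rewrite unitmx_inv => /(_ uS).
    by move=> /(can_inj (mulmxK uQ)).
  have uAP' : diag2 rho *m P' z \in unitmx by rewrite unitmx_mul uA unitmx_det.
  have /(can_inj (mulKmx uAP')) E : diag2 rho *m P' z *m (invmx (z *: A') *m L (q * z)) =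
      diag2 rho *m P' z *m (L z *m invmx (z *: A)).
    rewrite !mulmxA -P_eq'// P'L// P_eq//.
    by rewrite -[in RHS](mulmxA _ (P' z)) P'L.
  by rewrite -[L (q * z)](mulKVmx uzC') E -!mulmxA mulVmx// mulmx1.
- by move=> z z0; rewrite -P'L// mulmxK ?uL.
- by move=> z z0; rewrite LQ'.
Qed.

End Mano.

Unset Implicit Arguments.
Set Strict Implicit.

Theorem proposition5p9 (R : realType) (q : R[i])
    (rho sigma : 'I_2 -> R[i]) (x : 'I_4 -> R[i])
    (q_range : 0 < `|q| < 1)
    (rho_neq0 : forall i, rho i != 0)
    (sigma_neq0 : forall i, sigma i != 0)
    (x_neq0 : forall k, x k != 0)
    (hFR : FR q rho sigma x)
    (hNR : NR q rho sigma x)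
    (hNS : NS q rho sigma x)
    (M : R[i] -> 'M[R[i]]_2)
    (M_F : F_set q (diag2 rho) (diag2 sigma) x M)
    (P Q : R[i] -> 'M[R[i]]_2) (C : 'M[R[i]]_2)
    (PQ_Mano : Mano_decomposition q (diag2 rho) x M P Q C) :
  (forall (L : R[i] -> 'M[R[i]]_2) (C' : 'M[R[i]]_2),
     GL_holo L -> gauge_to q L C C' ->
     Mano_decomposition q (diag2 rho) x M
       (fun z => P z *m invmx (L z)) (fun z => L z *m Q z) C') /\
  (forall (P' Q' : R[i] -> 'M[R[i]]_2) (C' : 'M[R[i]]_2),
     Mano_decomposition q (diag2 rho) x M P' Q' C' ->
     exists L : R[i] -> 'M[R[i]]_2,
       [/\ GL_holo L, gauge_to q L C C',
           forall z, z != 0 -> P' z = P z *m invmx (L z) &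
           forall z, z != 0 -> Q' z = L z *m Q z]).
Proof.
have [_ _ x_incongruent] := hNR; split.
- move=> L C' GL_L gL.
  exact: (Mano_gauge q_range PQ_Mano GL_L gL).
- move=> P' Q' C'.
  exact: (Mano_unique q_range rho_neq0 sigma_neq0 x_neq0 x_incongruent M_F PQ_Mano).
Qed.
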